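(* Let $E$ be a real separable Hilbert space which is an orthogonal representation of a compact Lie group $G$, let $A\colon D(A)\subset E\to E$ be an equivariant unbounded self-adjoint operator with purely discrete spectrum and invariant domain, and let $f\in\mathcal{G}_G(E)$. If $\operatorname{Deg}^\nabla_G(f)\neq0$, then $f(x)=0$ for some $x\in D_f$.
   Context: **Hilbert setting.** $G$ is a compact Lie group, $E$ a real separable Hilbert space with an orthogonal $G$-action, $A\colon D(A)\subset E\to E$ a densely defined self-adjoint operator with purely discrete spectrum (the spectrum $\sigma(A)$ consists only of isolated eigenvalues of finite multiplicity), $D(A)$ is $G$-invariant and $A$ is $G$-equivariant. $E_1$ denotes $D(A)$ with the inner product $\langle x\mid y\rangle_1=\langle x\mid y\rangle+\langle Ax\mid Ay\rangle$; it is a Hilbert space. **Local maps.** $f\in\mathcal{G}_G(E)$ means: $f\colon D_f\subset E_1\to E$, where $D_f$ is an open invariant subset of $E_1$; $f(x)=Ax-\nabla\varphi(x)$ where $\varphi\colon E\to\mathbb{R}$ is $C^1$ and $G$-invariant; and $f^{-1}(0)$ is compact. **Euler–tom Dieck ring.** $\mathfrak{U}(G)$ is the set of classes of finite $G$-CW-complexes, $X$ and $Y$ being identified if $X^H/WH$ and $Y^H/WH$ have the same Euler characteristic for all closed subgroups $H\le G$ ($WH=NH/H$); addition is induced by disjoint union, multiplication by cartesian product with diagonal action. Additively it is free abelian on the elements $[G/H]$, one for each conjugacy class $(H)$ of closed subgroups; the unit is $[G/G]$. **Finite-dimensional degree.** Let $V$ be a finite-dimensional real orthogonal representation of $G$.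 $\mathcal{G}_G(V)$ is the set of continuous equivariant gradient maps $f$ from an open invariant subset of $V$ to $V$ with $f^{-1}(0)$ compact. A (gradient) otopy in $V$ is a continuous map $h\colon\Lambda\to V$, $\Lambda\subset[0,1]\times V$ open invariant (trivial action on $[0,1]$), with $h(t,\cdot)\in\mathcal{G}_G(V)$ for each $t$ and $h^{-1}(0)$ compact; $h(0,\cdot)$ and $h(1,\cdot)$ are then otopic. The equivariant gradient degree $\deg^\nabla_G\colon\mathcal{G}_G(V)\to\mathfrak{U}(G)$ (known from the literature) is the otopy invariant function such that, if $f$ has finitely many zero orbits $Gx_1,\dots,Gx_k$, and for each $i$, with $H_i=G_{x_i}$ and $V_{(H_i)}=\{x\in V: G_x\text{ conjugate to }H_i\}$, $f$ is $C^1$ near $Gx_i$, satisfies $f(x+v)=f(x)+v$ for $x\in V_{(H_i)}$ near $Gx_i$ and small $v\perp T_xV_{(H_i)}$, and the derivative at $x_i$ of $f|_{V_{(H_i)}}$ restricted to $T_{x_i}V_{(H_i)}\cap(T_{x_i}Gx_i)^\perp$ is an isomorphism $L_i$ of this space, then $\deg^\nabla_G(f)=\sum_i\operatorname{sign}\det(L_i)\,[G/H_i]$ (every $f\in\mathcal{G}_G(V)$ is otopic to such a map). It is additive on disjoint unions, vanishes for maps without zeros, and $\deg^\nabla_G(f\times f')=\deg^\nabla_G(f)\cdot\deg^\nabla_G(f')$. For an equivariant self-adjoint isomorphism $B$ of $V$, $\deg^\nabla_G(B)$ is invertible in $\mathfrak{U}(G)$ (it is the unit if $V=0$). **Degree in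 $E$.** For $\lambda\in\sigma(A)$ let $V(\lambda)$ be the eigenspace; $V_n=\bigoplus_{|\lambda|\le n}V(\lambda)$, $V^n=\bigoplus_{n-1<|\lambda|\le n}V(\lambda)$, $A_n=A|_{V^n}\colon V^n\to V^n$, and $P_n\colon E\to V_n$ is the orthogonal projection. Put $a_n=\deg^\nabla_G(A_n)$ and $m_n=a_1^{-1}\cdots a_n^{-1}$ for $n\ge1$. For $f=A-\nabla\varphi\in\mathcal{G}_G(E)$ choose an open bounded invariant $U\subset E_1$ with $f^{-1}(0)\subset U\subset\operatorname{cl}U\subset D_f$ (closure in $E_1$), set $U_n=U\cap V_n$ and $f_n\colon U_n\to V_n$, $f_n(x)=Ax-P_n\nabla\varphi(x)$. Then $\operatorname{Deg}^\nabla_G(f):=m_n\cdot\deg^\nabla_G(f_n)\in\mathfrak{U}(G)$ for $n$ large enough; this is independent of the choice of sufficiently large $n$ and of $U$. *)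

(* Defs.v *)
From HB Require Import structures.
From mathcomp Require Import all_boot all_order all_algebra.
From mathcomp Require Import all_classical all_reals all_analysis.
From mathcomp Require Import ring.

Set Implicit Arguments.
Unset Strict Implicit.
Unset Printing Implicit Defensive.

Import Order.TTheory GRing.Theory Num.Theory.
Import numFieldNormedType.Exports.

Local Open Scope classical_set_scope.
Local Open Scope ring_scope.

HB.mixin Record NormedModule_isInner (R : realType) E & NormedModule R E := {
  ip : E -> E -> R;
  ipC : forall x y, ip x y = ip y x;
  ip_linearl : forall a x y z, ip (a *: x + y) z = a * ip x z + ip y z;
  ip_norm : forall x, ip x x = `|x| ^+ 2
}.

#[short(type="innerType")]
HB.structure Definition InnerProduct (R : realType) :=
  {E of NormedModule R E & NormedModule_isInner R E}.

#[short(type="hilbertType")]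
HB.structure Definition Hilbert (R : realType) :=
  {E of InnerProduct R E & CompleteNormedModule R E}.

(* A positive definite symmetric bilinear form induces the norm. *)
HB.factory Record Lmodule_isInner (R : realType) E & GRing.Lmodule R E := {
  form : E -> E -> R;
  formC : forall x y, form x y = form y x;
  form_linearl : forall a x y z, form (a *: x + y) z = a * form x z + form y z;
  form_ge0 : forall x, 0 <= form x x;
  form_eq0 : forall x, form x x = 0 -> x = 0
}.

HB.builders Context R E & Lmodule_isInner R E.

Let nrm (x : E) : R := Num.sqrt (form x x).

Let form0l z : form 0 z = 0.
Proof.
have := form_linearl 1 0 0 z; rewrite scaler0 addr0 mul1r => h.
by apply: (addrI (form 0 z)); rewrite addr0 -h.
Qed.

Let formDl x y z : form (x + y) z = form x z + form y z.
Proof. by have := form_linearl 1 x y z; rewrite scale1r mul1r. Qed.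

Let formZl a x z : form (a *: x) z = a * form x z.
Proof. by have := form_linearl a x 0 z; rewrite addr0 form0l addr0. Qed.

Let formDD x y : form (x + y) (x + y) = form x x + 2 * form x y + form y y.
Proof.
rewrite formDl (formC x) (formC y) !formDl (formC y x) mulr_natl mulr2n.
by rewrite !addrA.
Qed.

Let formZZ a x : form (a *: x) (a *: x) = a ^+ 2 * form x x.
Proof. by rewrite formZl formC formZl mulrA expr2. Qed.

Let cauchy_schwarz x y : form x y ^+ 2 <= form x x * form y y.
Proof.
have [y0|yn0] := eqVneq (form y y) 0.
  by rewrite (form_eq0 y0) (formC x 0) !form0l expr0n mulr0.
have yp : 0 < form y y by rewrite lt_neqAle eq_sym yn0 form_ge0.
have := form_ge0 (form y y *: x + (- form x y) *: y).
rewrite formDD !formZZ formZl (formC x) formZl (formC y x) => h.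
have {h} : 0 <= form y y * (form x x * form y y - form x y ^+ 2).
  by apply: le_trans h _; rewrite le_eqVlt; apply/orP; left; apply/eqP; ring.
by rewrite pmulr_rge0// subr_ge0.
Qed.

Let nrmD x y : nrm (x + y) <= nrm x + nrm y.
Proof.
rewrite -(@ler_sqr _ (nrm (x + y))) ?nnegrE ?addr_ge0 ?sqrtr_ge0//.
rewrite sqrrD !sqr_sqrtr ?form_ge0// formDD lerD2r lerD2l.
rewrite -[leRHS]mulr_natl ler_pM2l ?ltr0n// -sqrtrM ?form_ge0//.
rewrite (le_trans (ler_norm _))// -sqrtr_sqr ler_sqrt ?cauchy_schwarz//.
by rewrite mulr_ge0 ?form_ge0.
Qed.

Let nrmZ (l : R) x : nrm (l *: x) = `|l| * nrm x.
Proof. by rewrite /nrm formZZ sqrtrM ?sqr_ge0// sqrtr_sqr. Qed.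

Let nrm_eq0 x : nrm x = 0 -> x = 0.
Proof.
move=> /eqP; rewrite sqrtr_eq0 => h; apply: form_eq0.
by apply/eqP; rewrite eq_le h form_ge0.
Qed.

HB.instance Definition _ := Lmodule_isNormed.Build R E nrmD nrmZ nrm_eq0.

Let form_norm x : form x x = `|x| ^+ 2.
Proof. by rewrite sqr_sqrtr ?form_ge0. Qed.

HB.instance Definition _ :=
  NormedModule_isInner.Build R E formC form_linearl form_norm.

HB.end.

Section InnerTheory.
Context {R : realType} {E : innerType R}.

Lemma ip_ge0 (x : E) : 0 <= ip x x.
Proof. by rewrite ip_norm sqr_ge0. Qed.

Lemma ip_eq0 (x : E) : ip x x = 0 -> x = 0.
Proof. by rewrite ip_norm => /eqP; rewrite sqrf_eq0 normr_eq0 => /eqP. Qed.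

End InnerTheory.

Record lin_subspace (R : realType) (E : lmodType R) := Subspace {
  sub_set :> E -> Prop;
  sub_set_closed :
    sub_set 0 /\ forall a x y, sub_set x -> sub_set y -> sub_set (a *: x + y)
}.

Section SubspaceType.
Context {R : realType} {E : lmodType R} (W : lin_subspace E).

Definition sub_pred : {pred E} := [pred x | `[< W x >]].

Lemma sub_pred_closed : submod_closed sub_pred.
Proof.
have [w0 wD] := sub_set_closed W.
by split=> [|a x y /asboolP hx /asboolP hy]; apply/asboolP; [|exact: wD].
Qed.

HB.instance Definition _ :=
  GRing.isSubmodClosed.Build R E sub_pred sub_pred_closed.

Definition sub_space : Type := {x : E | x \in sub_pred}.
HB.instance Definition _ := [isSub of sub_space for @sval _ _].
HB.instance Definition _ := [Choice of sub_space by <:].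
HB.instance Definition _ := [SubChoice_isSubLmodule of sub_space by <:].

End SubspaceType.

Section SubspaceInner.
Context {R : realType} {E : innerType R} (W : lin_subspace E).

Let form (x y : sub_space W) : R := ip (val x) (val y).

Let formC x y : form x y = form y x.
Proof. exact: ipC. Qed.

Let form_linearl a x y z : form (a *: x + y) z = a * form x z + form y z.
Proof. by rewrite /form linearP ip_linearl. Qed.

Let form_ge0 x : 0 <= form x x.
Proof. exact: ip_ge0. Qed.

Let form_eq0 x : form x x = 0 -> x = 0.
Proof. by move=> /ip_eq0 h; apply: val_inj; rewrite h raddf0. Qed.

HB.instance Definition _ := Lmodule_isInner.Build R (sub_space W)
  formC form_linearl form_ge0 form_eq0.

(* Compression of T to W; the default value 0 is used only where T leaves W. *)
Definition restr (T : E -> E) (x : sub_space W) : sub_space W :=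
  insubd 0 (T (val x)).

Definition orth_proj (x : E) : sub_space W :=
  xget 0 [set w | forall v : sub_space W, ip (x - val w) (val v) = 0].

End SubspaceInner.

Definition finite_dim (R : realType) (V : lmodType R) (S : set V) : Prop :=
  exists (d : nat) (b : 'I_d -> V),
    forall v, S v -> exists c : 'I_d -> R, v = \sum_i c i *: b i.

(* C^k on an open subset of a finite-dimensional space. *)
Fixpoint Ck (R : realType) (V W : normedModType R) (k : nat)
    (O : set V) (f : V -> W) : Prop :=
  (forall x, O x -> {for x, continuous f}) /\
  (if k is k'.+1 then
     (forall x, O x -> differentiable f x) /\
     (forall v, Ck k' O (fun x => 'D_v f x))
   else True).

Definition smooth_on (R : realType) (V W : normedModType R)
  (O : set V) (f : V -> W) : Prop := forall k, Ck k O f.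

#[short(type="topGroupType")]
HB.structure Definition TopGroup := {G of Topological G & Group G}.

Definition topological_group (G : topGroupType) : Prop :=
  continuous (fun p : G * G => (p.1 * p.2)%g) /\
  continuous (fun g : G => (g^-1)%g).

Record chart (R : realType) (G : topologicalType) (n : nat) := Chart {
  chart_dom : set G;
  chart_map : G -> 'rV[R]_n;
  chart_inv : 'rV[R]_n -> G
}.

Section Lie.
Context (R : realType) (G : topGroupType) (n : nat).
Implicit Types c : chart R G n.

Definition chart_cod c : set 'rV[R]_n := chart_map c @` chart_dom c.

Definition is_chart c : Prop :=
  [/\ open (chart_dom c), open (chart_cod c),
      (forall x, chart_dom c x -> {for x, continuous (chart_map c)}),
      (forall u, chart_cod c u -> {for u, continuous (chart_inv c)}) &
      (forall x, chart_dom c x -> chart_inv c (chart_map c x) = x)].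

Definition is_atlas (At : set (chart R G n)) : Prop :=
  [/\ (forall c, At c -> is_chart c),
      (forall g : G, exists2 c, At c & chart_dom c g) &
      (forall c c', At c -> At c' ->
        smooth_on (chart_map c @` (chart_dom c `&` chart_dom c'))
                  (chart_map c' \o chart_inv c))].

Definition smooth_mul (At : set (chart R G n)) : Prop :=
  forall a b c, At a -> At b -> At c ->
    let m := fun p : 'rV[R]_n * 'rV[R]_n =>
      (chart_inv a p.1 * chart_inv b p.2)%g in
    smooth_on [set p | [/\ chart_cod a p.1, chart_cod b p.2 &
                           chart_dom c (m p)]]
              (chart_map c \o m).

Definition smooth_inv (At : set (chart R G n)) : Prop :=
  forall a c, At a -> At c ->
    let i := fun u : 'rV[R]_n => ((chart_inv a u)^-1)%g in
    smooth_on [set u | chart_cod a u /\ chart_dom c (i u)]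
              (chart_map c \o i).

End Lie.

Definition compact_lie_group (R : realType) (G : topGroupType) : Prop :=
  [/\ topological_group G, hausdorff_space G, compact [set: G] &
      exists n (At : set (chart R G n)),
        [/\ is_atlas At, smooth_mul At & smooth_inv At]].

Section FibreQuotient.
Local Open Scope quotient_scope.
Context {T : topologicalType} {S : Type} (f : T -> S).

Let rel (x y : T) : bool := `[< f x = f y >].

Let rel_refl : reflexive rel.
Proof. by move=> x; apply/asboolP. Qed.

Let rel_sym : symmetric rel.
Proof. by move=> x y; apply/asboolP/asboolP. Qed.

Let rel_trans : transitive rel.
Proof. by move=> y x z /asboolP xy /asboolP yz; apply/asboolP; rewrite xy. Qed.

Definition fibre_rel := EquivRel rel rel_refl rel_sym rel_trans.
Definition fibre_quot := {eq_quot fibre_rel}.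
HB.instance Definition _ :=
  Topological.copy fibre_quot (quotient_topology fibre_quot).
HB.instance Definition _ := Quotient.on fibre_quot.

End FibreQuotient.

Section Groups.
Context {G : topGroupType}.

Definition closed_subgroup (H : set G) : Prop :=
  [/\ closed H, H 1%g, (forall g h, H g -> H h -> H (g * h)%g) &
      (forall g, H g -> H (g^-1)%g)].

Definition conj_set (g : G) (H : set G) : set G :=
  [set (g * h * g^-1)%g | h in H].

Definition normaliser (H : set G) : set G := [set g | conj_set g H = H].

Definition left_cosets (H : set G) :=
  fibre_quot (fun g : G => [set (g * h)%g | h in H]).

Definition coset_space (H : set G) : topologicalType := left_cosets H.

Definition coset_act (H : set G) (g : G) (C : coset_space H) : coset_space H :=
  (\pi_(left_cosets H) (g * repr (C : left_cosets H))%g)%qT.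

Definition is_action (X : topologicalType) (act : G -> X -> X) : Prop :=
  [/\ (forall x, act 1%g x = x),
      (forall g h x, act (g * h)%g x = act g (act h x)) &
      continuous (fun p : G * X => act p.1 p.2)].

Definition act_invariant (X : Type) (act : G -> X -> X) (S : set X) : Prop :=
  forall g x, S x -> S (act g x).

Definition stab (X : Type) (act : G -> X -> X) (x : X) : set G :=
  [set g | act g x = x].

Definition orbit_set (X : Type) (act : G -> X -> X) (x : X) : set X :=
  [set act g x | g in [set: G]].

Definition fixed (X : Type) (act : G -> X -> X) (H : set G) : set X :=
  [set x | forall h, H h -> act h x = x].

(* X^H / WH: the orbits of WH = NH/H on X^H are those of NH. *)
Definition weyl_quot (X : topologicalType) (act : G -> X -> X) (H : set G) :
    topologicalType :=
  fibre_quot (fun x : fixed act H => [set act g (val x) | g in normaliser H]).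

Definition orthogonal_rep (R : realType) (V : innerType R)
    (rho : G -> V -> V) : Prop :=
  [/\ is_action rho,
      (forall g a x y, rho g (a *: x + y) = a *: rho g x + rho g y) &
      (forall g x y, ip (rho g x) (rho g y) = ip x y)].

End Groups.

Section Disk.
Context {R : realType} {n : nat}.

Let sqnorm (v : 'rV[R]_n) : R := \sum_j v 0 j ^+ 2.

Definition disk : set 'rV[R]_n := [set v | sqnorm v <= 1].
Definition odisk : set 'rV[R]_n := [set v | sqnorm v < 1].
Definition sphere : set 'rV[R]_n := [set v | sqnorm v = 1].

End Disk.

(* A CW structure with finitely many cells on a Hausdorff space, given by its
   characteristic maps: the open cells partition the space, and the boundary of
   a cell lies in the union of the open cells of smaller dimension. *)
Definition CW_structure (R : realType) (Y : topologicalType) (I : finType)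
    (dim : I -> nat) (phi : forall i, 'rV[R]_(dim i) -> Y) : Prop :=
  [/\ hausdorff_space Y,
      (forall i, {within disk, continuous (phi i)}),
      (forall y, exists i, exists2 v, odisk v & phi i v = y),
      (forall i j v w, odisk v -> odisk w -> phi i v = phi j w ->
         existT (fun i => 'rV[R]_(dim i)) i v =
         existT (fun i => 'rV[R]_(dim i)) j w) &
      (forall i v, sphere v ->
         exists j, (dim j < dim i)%N /\ exists2 w, odisk w & phi j w = phi i v)].

Definition euler_char (R : realType) (Y : topologicalType) : int :=
  xget 0 [set k | exists (I : finType) (dim : I -> nat)
                    (phi : forall i, 'rV[R]_(dim i) -> Y),
                    CW_structure phi /\ k = \sum_i (-1) ^+ dim i].

(* The cell i is of type G/(H i) x D^(dim i). *)
Definition GCW_structure (R : realType) (G : topGroupType)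
    (X : topologicalType) (act : G -> X -> X) (I : finType)
    (dim : I -> nat) (H : I -> set G)
    (Phi : forall i, coset_space (H i) * 'rV[R]_(dim i) -> X) : Prop :=
  [/\ hausdorff_space X,
      (forall i, [/\ closed_subgroup (H i),
         {within [set p | disk p.2], continuous (Phi i)} &
         forall g C v, disk v -> Phi i (coset_act g C, v) = act g (Phi i (C, v))]),
      (forall x, exists i, exists2 p, odisk p.2 & Phi i p = x),
      (forall i j p q, odisk p.2 -> odisk q.2 -> Phi i p = Phi j q ->
         existT (fun i => (coset_space (H i) * 'rV[R]_(dim i))%type) i p =
         existT (fun i => (coset_space (H i) * 'rV[R]_(dim i))%type) j q) &
      (forall i p, sphere p.2 ->
         exists j, (dim j < dim i)%N /\
           exists2 q, odisk q.2 & Phi j q = Phi i p)].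

Definition finite_GCW (R : realType) (G : topGroupType)
    (X : topologicalType) (act : G -> X -> X) : Prop :=
  is_action act /\
  exists (I : finType) (dim : I -> nat) (H : I -> set G)
    (Phi : forall i, coset_space (H i) * 'rV[R]_(dim i) -> X),
    GCW_structure act Phi.

(* [UG], with the class map [cls], is the Euler-tom Dieck ring U(G).  The value
   of [cls] outside finite G-CW complexes is irrelevant.  These conditions
   determine the pair up to a unique isomorphism: since the products
   G/H x G/K are finite G-CW complexes, requiring the product rule only when
   the product space is itself a finite G-CW complex loses nothing. *)
Record euler_tom_dieck_ring (R : realType) (G : topGroupType)
    (UG : comUnitRingType)
    (cls : forall X : topologicalType, (G -> X -> X) -> UG) : Prop := {
  etd_surj : forall u : UG, exists (X : topologicalType) (act : G -> X -> X),
    finite_GCW R act /\ cls X act = u;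
  etd_eq : forall (X Y : topologicalType) (aX : G -> X -> X) (aY : G -> Y -> Y),
    finite_GCW R aX -> finite_GCW R aY ->
    (cls X aX = cls Y aY <->
     forall H : set G, closed_subgroup H ->
       euler_char R (weyl_quot aX H) = euler_char R (weyl_quot aY H));
  (* Z is the disjoint union of X and Y *)
  etd_add : forall (X Y Z : topologicalType) (aX : G -> X -> X)
      (aY : G -> Y -> Y) (aZ : G -> Z -> Z) (i : X -> Z) (j : Y -> Z),
    finite_GCW R aX -> finite_GCW R aY -> finite_GCW R aZ ->
    continuous i -> continuous j -> injective i -> injective j ->
    (forall g x, i (aX g x) = aZ g (i x)) ->
    (forall g y, j (aY g y) = aZ g (j y)) ->
    range i `&` range j = set0 -> range i `|` range j = [set: Z] ->
    cls Z aZ = cls X aX + cls Y aY;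
  etd_mul : forall (X Y : topologicalType) (aX : G -> X -> X)
      (aY : G -> Y -> Y),
    let aXY := fun g (p : X * Y) => (aX g p.1, aY g p.2) in
    finite_GCW R aX -> finite_GCW R aY -> finite_GCW R aXY ->
    cls (X * Y)%type aXY = cls X aX * cls Y aY
}.

Section FiniteDegree.
Context {R : realType} {G : topGroupType}.

Section Rep.
Context {V : innerType R} (rho : G -> V -> V).

(* f belongs to G_G(V), with domain Om; values outside Om are irrelevant. *)
Definition gradient_map (Om : set V) (f : V -> V) : Prop :=
  [/\ open Om /\ act_invariant rho Om,
      {within Om, continuous f},
      (forall g x, Om x -> f (rho g x) = rho g (f x)),
      (exists psi : V -> R, forall x, Om x ->
         differentiable psi x /\ forall v, 'd psi x v = ip (f x) v) &
      compact [set x | Om x /\ f x = 0]].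

Definition otopic (Om0 : set V) (f0 : V -> V) (Om1 : set V) (f1 : V -> V) :
    Prop :=
  exists (La : set (R * V)) (h : R * V -> V),
    [/\ (exists2 O : set (R * V), open O &
           La = O `&` [set p | 0 <= p.1 <= 1]) /\
        (forall g t x, La (t, x) -> La (t, rho g x)),
        {within La, continuous h},
        (forall t, 0 <= t <= 1 ->
           gradient_map [set x | La (t, x)] (fun x => h (t, x))),
        compact [set p | La p /\ h p = 0] &
        [/\ [set x | La (0, x)] = Om0, [set x | La (1, x)] = Om1,
            (forall x, Om0 x -> h (0, x) = f0 x) &
            (forall x, Om1 x -> h (1, x) = f1 x)]].

Definition stratum (H : set G) : set V :=
  [set x | exists g, stab rho x = conj_set g H].

(* The tangent space at x of a submanifold S: velocities of curves in S. *)
Definition tangent (S : set V) (x : V) : set V :=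
  [set v | exists gam : R -> V,
     [/\ gam 0 = x, \forall t \near (0 : R), S (gam t) &
         is_derive (0 : R) (1 : R) gam v]].

Definition normal_slice (x : V) : set V :=
  [set v | tangent (stratum (stab rho x)) x v /\
     forall w, tangent (orbit_set rho x) x w -> ip v w = 0].

Definition is_basis (S : set V) (d : nat) (e : 'I_d -> V) : Prop :=
  (forall v, S v <-> exists c : 'I_d -> R, v = \sum_i c i *: e i) /\
  (forall c : 'I_d -> R, \sum_i c i *: e i = 0 -> forall i, c i = 0).

(* Condition on f at the zero orbit of x; M is the matrix, in the basis e, of
   the restricted derivative L. *)
Definition nice_zero (Om : set V) (f : V -> V) (x : V)
    (d : nat) (e : 'I_d -> V) (M : 'M[R]_d) : Prop :=
  let S := stratum (stab rho x) in
  [/\ (exists O : set V,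
         [/\ open O, orbit_set rho x `<=` O, O `<=` Om, Ck 1 O f &
             exists2 eps : R, 0 < eps &
               forall y v, O y -> S y -> `|v| < eps ->
                 (forall w, tangent S y w -> ip v w = 0) ->
                 Om (y + v) /\ f (y + v) = f y + v]),
      is_basis (normal_slice x) e,
      (forall j, 'd f x (e j) = \sum_i M i j *: e i) &
      M \in unitmx].

End Rep.

(* [deg] is the equivariant gradient degree.  Every gradient map is otopic to
   one with nice zero orbits, so the two conditions determine it. *)
Record gradient_degree (UG : comUnitRingType)
    (cls : forall X : topologicalType, (G -> X -> X) -> UG)
    (deg : forall V : innerType R, (G -> V -> V) -> set V -> (V -> V) -> UG) :
    Prop := {
  deg_otopy : forall (V : innerType R) (rho : G -> V -> V),
    finite_dim [set: V] -> orthogonal_rep rho ->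
    forall Om0 f0 Om1 f1,
      gradient_map rho Om0 f0 -> gradient_map rho Om1 f1 ->
      otopic rho Om0 f0 Om1 f1 ->
      deg V rho Om0 f0 = deg V rho Om1 f1;
  deg_normal : forall (V : innerType R) (rho : G -> V -> V),
    finite_dim [set: V] -> orthogonal_rep rho ->
    forall Om f, gradient_map rho Om f ->
    forall (k : nat) (x : 'I_k -> V) (d : 'I_k -> nat)
      (e : forall i, 'I_(d i) -> V) (M : forall i, 'M[R]_(d i)),
      (forall y, (Om y /\ f y = 0) <-> exists i, orbit_set rho (x i) y) ->
      (forall i j, orbit_set rho (x i) (x j) -> i = j) ->
      (forall i, nice_zero rho Om f (x i) (e i) (M i)) ->
      deg V rho Om f =
        \sum_i cls (coset_space (stab rho (x i)))
                   (@coset_act G (stab rho (x i))) *~ sgz (\det (M i))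
}.

End FiniteDegree.

(* Values of the function outside the domain are irrelevant. *)
Record operator (R : realType) (E : lmodType R) := Operator {
  op_dom : lin_subspace E;
  op_fun :> E -> E;
  op_linear : forall a x y, op_dom x -> op_dom y ->
    op_fun (a *: x + y) = a *: op_fun x + op_fun y
}.

Section GraphSpace.
Context {R : realType} {E : innerType R} (A : operator E).

(* E_1: the domain with the inner product <x|y> + <Ax|Ay>. *)
Definition graph_space : Type := {x : E | x \in sub_pred (op_dom A)}.
HB.instance Definition _ := [isSub of graph_space for @sval _ _].
HB.instance Definition _ := [Choice of graph_space by <:].
HB.instance Definition _ := [SubChoice_isSubLmodule of graph_space by <:].

Let form (x y : graph_space) : R :=
  ip (val x) (val y) + ip (A (val x)) (A (val y)).

Let formC x y : form x y = form y x.
Proof. by rewrite /form ipC (ipC (A _)). Qed.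

Let form_linearl a x y z : form (a *: x + y) z = a * form x z + form y z.
Proof.
have hx (u : graph_space) : op_dom A (val u) by apply/asboolP/(valP u).
have e : val (a *: x + y) = a *: val x + val y by rewrite linearP.
rewrite /form e (op_linear a (hx x) (hx y)).
by rewrite !ip_linearl mulrDr addrACA.
Qed.

Let form_ge0 x : 0 <= form x x.
Proof. by rewrite addr_ge0 ?ip_ge0. Qed.

Let form_eq0 x : form x x = 0 -> x = 0.
Proof.
move=> /eqP; rewrite paddr_eq0 ?ip_ge0// => /andP[/eqP/ip_eq0 h _].
by apply: val_inj; rewrite h raddf0.
Qed.

HB.instance Definition _ := Lmodule_isInner.Build R graph_space
  formC form_linearl form_ge0 form_eq0.

End GraphSpace.

Section Spectrum.
Context {R : realType} {E : innerType R} (A : operator E).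

Definition densely_defined : Prop := dense (op_dom A).

(* The graph of the adjoint is the graph of A. *)
Definition self_adjoint : Prop :=
  forall y z, (forall x, op_dom A x -> ip (A x) y = ip x z) <->
              (op_dom A y /\ A y = z).

Definition resolvent_set : set R :=
  [set l | exists B : {linear E -> E},
     [/\ continuous B,
         (forall y, op_dom A (B y) /\ A (B y) - l *: B y = y) &
         (forall x, op_dom A x -> B (A x - l *: x) = x)]].

Definition spectrum : set R := ~` resolvent_set.

Definition eigenspace_op (l : R) : set E :=
  [set x | op_dom A x /\ A x = l *: x].

Definition purely_discrete_spectrum : Prop :=
  forall l, spectrum l ->
    [/\ (exists2 eps : R, 0 < eps &
           forall m, spectrum m -> `|m - l| < eps -> m = l),
        (exists2 x, x != 0 & eigenspace_op l x) &
        finite_dim (eigenspace_op l)].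

(* The sum of the eigenspaces for the l in B `&` spectrum. *)
Definition spectral_set (B : set R) : set E :=
  [set x | exists2 s : seq E,
     (forall y, y \in s ->
        exists2 l, spectrum l /\ B l & eigenspace_op l y) &
     x = \sum_(y <- s) y].

Lemma spectral_set_closed (B : set R) :
  spectral_set B 0 /\
  forall a x y, spectral_set B x -> spectral_set B y ->
    spectral_set B (a *: x + y).
Proof.
split; first by exists [::] => //; rewrite big_nil.
move=> a x y [s hs ->] [t ht ->].
exists ([seq a *: u | u <- s] ++ t); last first.
  by rewrite big_cat big_map /= scaler_sumr.
move=> z; rewrite mem_cat => /orP[/mapP[u us ->]|/ht//].
have [l hl [ud ue]] := hs _ us; exists l => //.
have [d0 dL] := sub_set_closed (op_dom A).
have A0 : A 0 = 0.
  have := op_linear 1 d0 d0; rewrite scaler0 addr0 scale1r => h.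
  by apply: (addrI (A 0)); rewrite addr0 -h.
split; first by have := dL a _ _ ud d0; rewrite addr0.
have := op_linear a ud d0; rewrite addr0 A0 addr0 => ->.
by rewrite ue !scalerA mulrC.
Qed.

Definition spectral_subspace (B : set R) : lin_subspace E :=
  Subspace (spectral_set_closed B).

(* V_n *)
Definition Vle (n : nat) : lin_subspace E :=
  spectral_subspace [set l | `|l| <= n%:R].

(* V^n *)
Definition Vshell (n : nat) : lin_subspace E :=
  spectral_subspace [set l | n%:R - 1 < `|l| <= n%:R].

End Spectrum.

Section HilbertDegree.
Context {R : realType} {G : topGroupType} {E : innerType R}.
Context (rho : G -> E -> E) (A : operator E).

Definition equivariant_op : Prop :=
  act_invariant rho (op_dom A) /\
  forall g x, op_dom A x -> A (rho g x) = rho g (A x).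

Definition C1_functional (phi : E -> R) : Prop :=
  (forall x, differentiable phi x) /\
  (forall x (eps : R), 0 < eps ->
     \forall y \near x, forall v, `|'d phi y v - 'd phi x v| <= eps * `|v|).

Definition is_gradient (phi : E -> R) (grad : E -> E) : Prop :=
  forall x v, 'd phi x v = ip (grad x) v.

Definition invariant1 (S : set (graph_space A)) : Prop :=
  forall g (x y : graph_space A), S x -> val y = rho g (val x) -> S y.

(* The elements of G_G(E). *)
Record local_map := LocalMap {
  lm_dom : set (graph_space A);
  lm_pot : E -> R;
  lm_grad : E -> E;
  lm_dom_open : open lm_dom;
  lm_dom_inv : invariant1 lm_dom;
  lm_pot_C1 : C1_functional lm_pot;
  lm_pot_inv : forall g x, lm_pot (rho g x) = lm_pot x;
  lm_gradP : is_gradient lm_pot lm_grad;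
  lm_compact : compact [set x : graph_space A |
    lm_dom x /\ A (val x) - lm_grad (val x) = 0]
}.

Definition lm_fun (f : local_map) (x : graph_space A) : E :=
  A (val x) - lm_grad f (val x).

Definition admissible (f : local_map) (U : set (graph_space A)) : Prop :=
  [/\ open U, bounded_set U, invariant1 U,
      [set x | lm_dom f x /\ lm_fun f x = 0] `<=` U &
      closure U `<=` lm_dom f].

Definition approx_dom (U : set (graph_space A)) (n : nat) :
    set (sub_space (Vle A n)) :=
  [set x | exists2 y, U y & val y = val x].

Definition approx_fun (f : local_map) (n : nat)
    (x : sub_space (Vle A n)) : sub_space (Vle A n) :=
  restr A x - orth_proj (Vle A n) (lm_grad f (val x)).

Context (UG : comUnitRingType).
Context (deg : forall V : innerType R, (G -> V -> V) -> set V -> (V -> V) -> UG).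

Definition rho_on (W : lin_subspace E) (g : G) : sub_space W -> sub_space W :=
  restr (rho g).

Definition deg_shell (n : nat) : UG :=
  @deg (sub_space (Vshell A n)) (@rho_on (Vshell A n)) setT (restr A).

Definition deg_factor (n : nat) : UG :=
  \prod_(1 <= i < n.+1) (deg_shell i)^-1.

(* The value m_n deg(f_n) for large n, for some choice of U.  It exists and does
   not depend on U, so that the default value 0 is never used. *)
Definition Deg (f : local_map) : UG :=
  xget 0 [set u | exists2 U, admissible f U &
    \forall n \near \oo,
      u = deg_factor n *
          @deg (sub_space (Vle A n)) (@rho_on (Vle A n))
              (@approx_dom U n) (@approx_fun f n)].

End HilbertDegree.

Definition separable (T : topologicalType) : Prop :=
  exists2 D : set T, countable D & dense D.

(* Main.v *)
From HB Require Import structures.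
Require Import Defs.
From mathcomp Require Import all_boot all_order all_algebra.
From mathcomp Require Import all_classical all_reals all_analysis.
From mathcomp Require Import ring lra.

Set Implicit Arguments.
Unset Strict Implicit.
Unset Printing Implicit Defensive.

Import Order.TTheory GRing.Theory Num.Theory.
Import numFieldNormedType.Exports.

Local Open Scope classical_set_scope.
Local Open Scope ring_scope.

(** Suppose that the degree is nonzero.  It is computed from the approximations
f_n = A - P_n grad on a bounded set U.  A gradient map without zeros on a
finite-dimensional representation has degree zero, being an empty sum over its
zero orbits ([degree_no_zero], applied to f_n thanks to
[approx_gradient_map]).  Hence f_n has a zero x_n in U for infinitely many n,
and it remains to extract from the x_n a limit in the graph norm
([zero_of_approx_zeros]).

The x_n are bounded in the graph norm, say by C.  Since A x_n = P_n grad(x_n),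
it is enough that x_n converges in E along an ultrafilter: then grad(x_n)
converges, hence so does A x_n, because P_n -> 1 strongly, and A is closed.  The
limit lies in the closure of U and is a zero of f.  Convergence in E is the
compactness of the embedding of the graph space into E: the P_N x_n are bounded
in a fixed finite-dimensional space, and |x_n - P_N x_n| <= 2 C / N.

The last estimate, [spectral_tail_bound], is where the spectral hypotheses
enter.  It follows from |A x| >= N |x| for x in the domain of A orthogonal to
V_N ([spectral_gap]).  Boundedness below of A - t takes over the
role of the resolvent set, and three facts are combined.
- A self-adjoint A - t that is bounded below on the complement of a
  finite-dimensional invariant subspace maps onto this complement
  ([opshift_surj]).
- If A - u is bounded below there for all u with |u - t| < r, then
  |(A - t) x| >= r |x| there ([gap_of_bounded_below]).
- If t is isolated in the spectrum, then A - t is bounded below on the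
  orthogonal complement of its kernel ([isolated_bounded_below]).
By the last fact A - u is bounded below on the complement of V_N for all u with
|u| < N, and the second one, for t = 0, gives the estimate. *)

(** * Inner products *)

Lemma discriminant_le (R : realFieldType) (a b c : R) : 0 <= c ->
  (forall t, 0 <= a + 2 * t * b + t ^+ 2 * c) -> b ^+ 2 <= a * c.
Proof.
move=> c_ge0 h.
have [c0|cn0] := eqVneq c 0.
  have [->|bn0] := eqVneq b 0; first by rewrite c0 mulr0 expr0n.
  have := h (- (a + 1) / (2 * b)).
  have -> : 2 * (- (a + 1) / (2 * b)) * b = - (a + 1) by field.
  by rewrite c0; lra.
have cp : 0 < c by rewrite lt_neqAle eq_sym cn0.
have := h (- b / c); have -> : 2 * (- b / c) * b = - 2 * (b ^+ 2 / c) by field.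
have -> : (- b / c) ^+ 2 * c = b ^+ 2 / c by field.
by move=> h2; rewrite -ler_pdivrMr //; lra.
Qed.

Section Inner.
Context {R : realType} {E : innerType R}.
Implicit Types (x y z : E) (a : R).

Lemma ip0l z : ip 0 z = 0.
Proof.
by have := ip_linearl 1 0 0 z; rewrite scaler0 addr0 mul1r; lra.
Qed.

Lemma ip0r z : ip z 0 = 0.
Proof. by rewrite ipC ip0l. Qed.

Lemma ipDl x y z : ip (x + y) z = ip x z + ip y z.
Proof. by have := ip_linearl 1 x y z; rewrite scale1r mul1r. Qed.

Lemma ipZl a x z : ip (a *: x) z = a * ip x z.
Proof. by have := ip_linearl a x 0 z; rewrite addr0 ip0l addr0. Qed.

Lemma ipNl x z : ip (- x) z = - ip x z.
Proof. by rewrite -scaleN1r ipZl mulN1r. Qed.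

Lemma ipBl x y z : ip (x - y) z = ip x z - ip y z.
Proof. by rewrite ipDl ipNl. Qed.

Lemma ipDr x y z : ip z (x + y) = ip z x + ip z y.
Proof. by rewrite !(ipC z) ipDl. Qed.

Lemma ipZr a x z : ip z (a *: x) = a * ip z x.
Proof. by rewrite !(ipC z) ipZl. Qed.

Lemma ipNr x z : ip z (- x) = - ip z x.
Proof. by rewrite !(ipC z) ipNl. Qed.

Lemma ipBr x y z : ip z (x - y) = ip z x - ip z y.
Proof. by rewrite ipDr ipNr. Qed.

Definition ipE := (ipDl, ipDr, ipBl, ipBr, ipNl, ipNr, ipZl, ipZr).

Lemma ip_suml (I : eqType) (s : seq I) (F : I -> E) z :
  ip (\sum_(i <- s) F i) z = \sum_(i <- s) ip (F i) z.
Proof. by elim/big_rec2: _ => [|i u v _ <-]; rewrite ?ip0l ?ipDl. Qed.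

Lemma cauchy_schwarz_ip x y : `|ip x y| <= `|x| * `|y|.
Proof.
rewrite -(@ler_pXn2r _ 2) ?nnegrE ?mulr_ge0 // exprMn real_normK ?num_real //.
rewrite -!ip_norm; apply: discriminant_le; first exact: ip_ge0.
move=> t; have := ip_ge0 (x + t *: y); rewrite !ipE (ipC y x).
by congr (0 <= _); ring.
Qed.

Lemma le_ip_norm x y : ip x y <= `|x| * `|y|.
Proof. exact: le_trans (ler_norm _) (cauchy_schwarz_ip x y). Qed.

Lemma ip_ext x y : (forall z, ip x z = ip y z) -> x = y.
Proof.
move=> h; apply/eqP; rewrite -subr_eq0; apply/eqP/ip_eq0.
by rewrite ipBl h subrr.
Qed.

End Inner.

(** * Parseval frames of finite-dimensional subspaces *)

Section Projection.
Context {R : realType} {E : innerType R}.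
Implicit Types (x y z e : E) (a : R) (s : seq E) (S : lin_subspace E).

Lemma subD S x y : S x -> S y -> S (x + y).
Proof.
by move=> Sx Sy; have := (sub_set_closed S).2 1 _ _ Sx Sy; rewrite scale1r.
Qed.

Lemma subZ S a x : S x -> S (a *: x).
Proof.
move=> Sx; have [S0 h] := sub_set_closed S.
by have := h a _ _ Sx S0; rewrite addr0.
Qed.

Lemma subB S x y : S x -> S y -> S (x - y).
Proof. by move=> Sx Sy; rewrite -scaleN1r; apply: subD => //; apply: subZ. Qed.

Lemma sub0 S : S 0.
Proof. exact: (sub_set_closed S).1. Qed.

Lemma sub_sum S (I : eqType) (s : seq I) (F : I -> E) :
  (forall i, i \in s -> S (F i)) -> S (\sum_(i <- s) F i).
Proof.
elim: s => [|i s IH] h; first by rewrite big_nil; apply: sub0.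
rewrite big_cons; apply: subD; first by apply: h; rewrite mem_head.
by apply: IH => j js; apply: h; rewrite inE js orbT.
Qed.

(** The frame operator of the finite list [s]. *)
Definition lproj s x : E := \sum_(e <- s) ip x e *: e.

Lemma lproj_linear s a x y : lproj s (a *: x + y) = a *: lproj s x + lproj s y.
Proof.
rewrite /lproj scaler_sumr -big_split /=; apply: eq_bigr => e _.
by rewrite !ipE scalerDl scalerA.
Qed.

Lemma lprojB s x y : lproj s (x - y) = lproj s x - lproj s y.
Proof. by rewrite addrC -scaleN1r lproj_linear scaleN1r addrC. Qed.

Lemma lproj_sym s x y : ip (lproj s x) y = ip x (lproj s y).
Proof.
rewrite /lproj ip_suml ipC ip_suml; apply: eq_bigr => e _.
by rewrite !ipE (ipC e y) (ipC e x) mulrC.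
Qed.

(** The frame operator is symmetric and has its image in the span of [s], so this
condition makes it the orthogonal projection onto that span.  Unlike
orthonormality, it is stated without a case distinction on indices. *)
Definition parseval_frame s := forall e, e \in s -> lproj s e = e.

Lemma lproj_mem S s x : (forall e, e \in s -> S e) -> S (lproj s x).
Proof. by move=> h; apply: sub_sum => e es; apply/subZ/h. Qed.

Lemma lproj_idem s x : parseval_frame s -> lproj s (lproj s x) = lproj s x.
Proof.
move=> hs; apply: ip_ext => z; rewrite -[RHS]addr0 lproj_sym.
rewrite /lproj !ip_suml addr0 big_seq [RHS]big_seq; apply: eq_bigr => e es.
by rewrite !ipE -(lproj_sym s) hs.
Qed.

Lemma lproj_perp s x e : parseval_frame s -> e \in s -> ip (x - lproj s x) e = 0.
Proof. by move=> hs es; rewrite ipBl lproj_sym hs // subrr. Qed.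

Lemma lproj_eq0 s x : (forall e, e \in s -> ip x e = 0) -> lproj s x = 0.
Proof.
by move=> h; rewrite /lproj big_seq big1 // => e es; rewrite h // scale0r.
Qed.

Lemma lproj_norm s x : parseval_frame s -> `|lproj s x| <= `|x|.
Proof.
move=> hs; have := le_ip_norm x (lproj s x).
rewrite -[in leLHS](lproj_idem x hs) -lproj_sym ip_norm expr2.
have [->|n0] := eqVneq (lproj s x) 0; first by rewrite normr0.
by rewrite ler_pM2r // normr_gt0.
Qed.

Fixpoint fspan (b : seq E) (v : E) : Prop :=
  if b is u :: b' then exists a, fspan b' (v - a *: u) else v = 0.

Lemma fspan_closed b :
  fspan b 0 /\ forall a x y, fspan b x -> fspan b y -> fspan b (a *: x + y).
Proof.
elim: b => [|u b [IH0 IH]] /=.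
  by split=> // a x y -> ->; rewrite scaler0 addr0.
split; first by exists 0; rewrite scale0r subr0.
move=> a x y [c hx] [d hy]; exists (a * c + d).
have -> : a *: x + y - (a * c + d) *: u = a *: (x - c *: u) + (y - d *: u).
  by rewrite scalerBr scalerDl scalerA opprD addrACA.
exact: IH.
Qed.

Definition span_of b := Subspace (fspan_closed b).

Lemma cap_closed S1 S2 :
  (S1 0 /\ S2 0) /\ forall a x y, S1 x /\ S2 x -> S1 y /\ S2 y ->
    S1 (a *: x + y) /\ S2 (a *: x + y).
Proof.
split; first by split; apply: sub0.
by move=> a x y [? ?] [? ?]; split; apply: subD => //; apply: subZ.
Qed.

Definition cap_sub S1 S2 : lin_subspace E := Subspace (cap_closed S1 S2).

(** One step of the Gram-Schmidt process: [r] is orthogonal to the span of [s]. *)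
Lemma parseval_frame_cons s r : parseval_frame s -> lproj s r = 0 -> r != 0 ->
  parseval_frame ((`|r|^-1 *: r) :: s).
Proof.
move=> hs hr rn0; set e0 := _ *: r.
have nr : `|r| != 0 by rewrite normr_eq0.
have pe0 : lproj s e0 = 0.
  by have := lproj_linear s `|r|^-1 r 0; rewrite hr scaler0 !addr0 => ->;
     rewrite add0r lproj_eq0 // => e _; rewrite ip0l.
have e01 : ip e0 e0 = 1 by rewrite /e0 !ipE ip_norm; field.
move=> e; rewrite inE => /orP[/eqP ->|es]; rewrite {1}/lproj big_cons -/(lproj s _).
  by rewrite e01 scale1r pe0 addr0.
by rewrite -{1}(hs _ es) lproj_sym pe0 ip0r scale0r add0r hs.
Qed.

(** Induction on the spanning list [b], which need not be contained in [S].  The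
vectors of [S] in the span of the tail of [b] have a frame by induction; if they
do not exhaust [S], any [w] in [S] outside them spans the rest modulo them,
since the coefficient of [w] along the head of [b] is nonzero. *)
Lemma finite_parseval_frame b S : (forall v, S v -> fspan b v) ->
  exists s, [/\ parseval_frame s, (forall e, e \in s -> S e) &
                forall v, S v -> lproj s v = v].
Proof.
elim: b S => [|u b IH] S hS.
  by exists [::]; split=> // v /hS /= ->; rewrite /lproj big_nil.
have [s [s1 s2 s3]] := IH (cap_sub S (span_of b)) (fun v h => h.2).
have [all|nall] := pselect (forall v, S v -> fspan b v).
  exists s; split=> // [e /s2[]//|v Sv]; apply: s3; split=> //; exact: all.
have [w /not_implyP[Sw nw]] : exists v, ~ (S v -> fspan b v).
  by apply/existsNP.
pose r := w - lproj s w.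
have ps v : (S v -> S (lproj s v)) by move=> _; apply: lproj_mem => e /s2[].
have pr : lproj s r = 0 by rewrite /r lprojB lproj_idem // subrr.
have rn0 : r != 0.
  apply/eqP => /eqP; rewrite subr_eq0 => /eqP we; apply: nw.
  by rewrite we; apply: (@lproj_mem (span_of b)) => e /s2[].
exists ((`|r|^-1 *: r) :: s); split; first exact: parseval_frame_cons.
  move=> e; rewrite inE => /orP[/eqP ->|/s2[]//].
  by apply: subZ; apply: subB => //; apply: ps.
have [a /= ha] := hS _ Sw.
have an0 : a != 0.
  by apply: contra_notN nw => /eqP a0; move: ha; rewrite a0 scale0r subr0.
move=> v Sv; have [c /= hc] := hS _ Sv.
have hv : lproj s (v - (c / a) *: w) = v - (c / a) *: w.
  apply: s3; split; first by apply: subB => //; apply: subZ.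
  have -> : v - (c / a) *: w = (v - c *: u) - (c / a) *: (w - a *: u).
    by rewrite scalerBr scalerA divfK // opprB addrA subrK.
  by apply: subB => //; apply: subZ.
(* v = p + t r with p in the span of s *)
pose t := c / a; pose p := v - t *: r.
have hp : lproj s p = p.
  have -> : p = (v - t *: w) + t *: lproj s w.
    by rewrite /p /r scalerBr opprB addrA addrAC.
  rewrite addrC lproj_linear lproj_idem //; congr (_ + _); exact: hv.
have -> : v = t *: r + p by rewrite /p addrC subrK.
have hr : ip r r = `|r| ^+ 2 by rewrite ip_norm.
have nr : `|r| != 0 by rewrite normr_eq0.
rewrite /lproj big_cons -/(lproj s _) lproj_linear pr scaler0 add0r hp.
congr (_ + _).
have pr0 : ip p r = 0 by rewrite -hp lproj_sym pr ip0r.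
rewrite ipDl ipZl !(ipZr _ r) hr pr0 mulr0 addr0 scalerA.
by congr (_ *: _); field; exact: nr.
Qed.

End Projection.

Section Span.
Context {R : realType} {E : innerType R}.
Implicit Types (u v : E) (b : seq E).

Lemma fspan_mem b u : u \in b -> fspan b u.
Proof.
elim: b => // w b IH; rewrite inE => /orP[/eqP ->|ub].
  by exists 1; rewrite scale1r subrr; apply: (sub0 (span_of b)).
by exists 0; rewrite scale0r subr0; apply: IH.
Qed.

Lemma fspan_le b1 b2 v :
  (forall u, u \in b1 -> fspan b2 u) -> fspan b1 v -> fspan b2 v.
Proof.
elim: b1 v => [|w b1 IH] v h /=; first by move=> ->; apply: (sub0 (span_of b2)).
move=> [a ha]; rewrite -(subrK (a *: w) v).
apply: (@subD _ _ (span_of b2)).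
  by apply: IH ha => u ub; apply: h; rewrite inE ub orbT.
by apply: (@subZ _ _ (span_of b2)); apply: h; rewrite mem_head.
Qed.

Lemma finite_dim_span (S : set E) : finite_dim S ->
  exists b, forall v, S v -> fspan b v.
Proof.
move=> [d [e he]]; exists (codom e) => v /he[c ->].
apply: (@sub_sum _ _ (span_of (codom e))) => i _.
by apply: (@subZ _ _ (span_of (codom e))); apply/fspan_mem/codom_f.
Qed.

End Span.

(** * Limits and density in a Hilbert space *)

Section Limits.
Context {R : realType}.

Lemma ip_cvg (E : innerType R) (T : Type) (F : set_system T) {FF : Filter F}
    (u v : T -> E) (x y : E) :
  u t @[t --> F] --> x -> v t @[t --> F] --> y ->
  ip (u t) (v t) @[t --> F] --> ip x y.
Proof.
move=> ux vy.
have polar a b : ip a b = 4^-1 * (`|a + b| ^+ 2 - `|a - b| ^+ 2) :> R.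
  by rewrite -!ip_norm !ipE (ipC b a); field.
have sq (w : T -> E) (z : E) :
    w t @[t --> F] --> z -> `|w t| ^+ 2 @[t --> F] --> `|z| ^+ 2.
  by move=> /cvg_norm wz; rewrite expr2; apply: cvgM.
rewrite polar; under eq_fun do rewrite polar.
apply: cvgM; first exact: cvg_cst.
by apply: cvgB; apply: sq; [exact: cvgD|exact: cvgB].
Qed.

Lemma ip_cvgl (E : innerType R) (T : Type) (F : set_system T) {FF : Filter F}
    (u : T -> E) (x y : E) :
  u t @[t --> F] --> x -> ip (u t) y @[t --> F] --> ip x y.
Proof. by move=> ux; apply: ip_cvg => //; apply: cvg_cst. Qed.

Lemma ip_eq0_cvg (E : innerType R) (T : Type) (F : set_system T)
    {FF : ProperFilter F} (u : T -> E) (x y : E) :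
  u t @[t --> F] --> x -> (forall t, ip (u t) y = 0) -> ip x y = 0.
Proof.
move=> ux u0.
have h : ip (u t) y @[t --> F] --> ip x y by exact: ip_cvgl.
have h0 : ip (u t) y @[t --> F] --> (0 : R).
  by under eq_fun do rewrite u0; apply: cvg_cst.
exact: (cvg_unique (@Rhausdorff R) h h0).
Qed.

Lemma cauchy_limit (E : completeNormedModType R) (T : Type) (F : set_system T)
    {FF : ProperFilter F} (u : T -> E) :
  (forall eps : R, 0 < eps -> exists2 B, F B &
     forall s t, B s -> B t -> `|u s - u t| < eps) ->
  exists x : E, u t @[t --> F] --> x.
Proof.
move=> h; suff /cvg_ex : cvg (u @ F) by [].
apply: cauchy_cvg; apply: cauchy_exP => eps eps0.
have [B FB hB] := h _ eps0; have [t Bt] := filter_ex FB.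
exists (u t); suff : F (u @^-1` ball (u t) eps) by [].
by apply: filterS FB => s Bs; rewrite /= -ball_normE /=; apply: hB.
Qed.

Lemma inv_lt_eventually (eps : R) : 0 < eps ->
  exists N : nat, forall n, (N <= n)%N -> n.+1%:R^-1 < eps.
Proof.
move=> eps0; have [N _ hN] := near_infty_natSinv_lt (PosNum eps0).
by exists N => n Nn; apply: hN.
Qed.

End Limits.

Section Density.
Context {R : realType} {E : hilbertType R}.

Lemma parallelogram (x y : E) :
  `|x - y| ^+ 2 = 2 * `|x| ^+ 2 + 2 * `|y| ^+ 2 - 4 * `|2^-1 *: (x + y)| ^+ 2.
Proof. by rewrite -!ip_norm !ipE (ipC y x); field. Qed.

(** Projection theorem: a minimizing sequence [m] for the distance from [z] to [M]
is Cauchy by the parallelogram identity, and [z] minus its limit [p] is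
orthogonal to [M].  By hypothesis [z] is then orthogonal to [z - p]; so is [p],
hence [z = p]. *)
Lemma dense_of_perp (M : lin_subspace E) (z : E) :
  (forall w, (forall m, M m -> ip m w = 0) -> ip z w = 0) ->
  forall eps : R, 0 < eps -> exists2 m, M m & `|z - m| < eps.
Proof.
move=> zM.
pose D := [set r : R | exists2 m, M m & r = `|z - m| ^+ 2].
have D0 : D !=set0 by exists (`|z - 0| ^+ 2), 0 => //; apply: sub0.
have Dlb : has_lbound D by exists 0 => _ [m _ ->]; rewrite exprn_ge0.
have Dinf : has_inf D by [].
pose d := inf D.
have dM m : M m -> d <= `|z - m| ^+ 2.
  by move=> Mm; apply: ge_inf => //; exists m.
have /choice[m hm] : forall k : nat, exists m,
    M m /\ `|z - m| ^+ 2 < d + k.+1%:R^-1.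
  move=> k; have ik : 0 < (k.+1%:R : R)^-1 by rewrite invr_gt0.
  by have [_ [m Mm ->] lt] := inf_adherent ik Dinf; exists m.
have [p mp] : exists p : E, m k @[k --> \oo] --> p.
  apply: cauchy_limit => eps eps0.
  have e0 : 0 < eps ^+ 2 / 4 by rewrite divr_gt0 // exprn_gt0.
  have [N hN] := inv_lt_eventually e0.
  exists [set k | (N <= k)%N]; first by exists N.
  move=> j k /= Nj Nk; rewrite -(@ltr_pXn2r _ 2) ?nnegrE ?(ltW eps0) //.
  have -> : m j - m k = (z - m k) - (z - m j) by rewrite opprB [RHS]addrC subrKA.
  rewrite parallelogram.
  have : d <= `|2^-1 *: (z - m k + (z - m j))| ^+ 2.
    have -> : 2^-1 *: (z - m k + (z - m j)) = z - 2^-1 *: (m k + m j).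
      rewrite addrACA -opprD scalerBr -mulr2n -[z *+ 2](scaler_nat 2 z).
      by rewrite scalerA mulVf // scale1r.
    by apply: dM; apply/subZ/subD; exact: (hm _).1.
  move: (hm j).2 (hm k).2 (hN _ Nj) (hN _ Nk).
  set a := `|z - m j| ^+ 2; set b := `|z - m k| ^+ 2.
  set e := _ ^+ 2; set f := `|_| ^+ 2; set i := _^-1; set l := _^-1; lra.
have zp n : M n -> ip n (z - p) = 0.
  move=> Mn; have hk k : ip (z - m k) n ^+ 2 <= k.+1%:R^-1 * `|n| ^+ 2.
    apply: discriminant_le; first by rewrite exprn_ge0.
    move=> t; have := dM _ (subB (hm k).1 (subZ t Mn)); have := (hm k).2.
    rewrite opprB addrA addrAC -!ip_norm; move: (z - m k) => v.
    rewrite (ipDl v) !(ipDr _ _ v) !(ipDr _ _ (_ *: n)) !ipZr !ipZl (ipC n v).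
    set i := _^-1; lra.
  rewrite ipC; apply/eqP; rewrite -sqrf_eq0 eq_le sqr_ge0 andbT.
  have cv : ip (z - m k) n ^+ 2 @[k --> \oo] --> ip (z - p) n ^+ 2.
    have h : ip (z - m k) n @[k --> \oo] --> ip (z - p) n.
      by apply: ip_cvgl; apply: cvgB => //; apply: cvg_cst.
    by rewrite expr2; apply: cvgM.
  apply: (ler_cvg_to cv (_ : k.+1%:R^-1 * `|n| ^+ 2 @[k --> \oo] --> (0 : R))).
    rewrite -(mul0r (`|n| ^+ 2)); apply: cvgM; last exact: cvg_cst.
    exact: cvg_harmonic.
  by near=> k; exact: hk.
have zzp : ip z (z - p) = 0 by apply: zM.
have pzp : ip p (z - p) = 0.
  by apply: (ip_eq0_cvg mp) => k; apply/zp/(hm k).1.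
have /eqP : z - p = 0 by apply: ip_eq0; rewrite {1}ipBl zzp pzp subrr.
rewrite subr_eq0 => /eqP -> eps eps0.
have /cvgrPdist_lt/(_ _ eps0)[N _ hN] := mp.
by exists (m N); [exact: (hm N).1|apply: hN => /=].
Unshelve. all: by end_near. Qed.

End Density.

(** * Self-adjoint operators bounded below *)

Section SelfAdjoint.
Context {R : realType} {E : hilbertType R} (A : operator E).
Hypothesis hA : self_adjoint A.
Local Notation D := (op_dom A).
Implicit Types (x y z e : E) (s : seq E) (t a b : R).

Lemma op_Z a x : D x -> A (a *: x) = a *: A x.
Proof.
move=> Dx; have D0 := sub0 D.
have A0 : A 0 = 0.
  have := op_linear 1 D0 D0; rewrite scaler0 addr0 scale1r => h.
  by apply: (addrI (A 0)); rewrite addr0 -h.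
by have := op_linear a Dx D0; rewrite A0 !addr0.
Qed.

Lemma op_D x y : D x -> D y -> A (x + y) = A x + A y.
Proof. by move=> Dx Dy; have := op_linear 1 Dx Dy; rewrite !scale1r. Qed.

Lemma op_B x y : D x -> D y -> A (x - y) = A x - A y.
Proof.
move=> Dx Dy; rewrite -(scaleN1r y) -(scaleN1r (A y)) -op_Z // op_D //.
exact: subZ.
Qed.

Lemma op_sym x y : D x -> D y -> ip (A x) y = ip x (A y).
Proof. by move=> Dx Dy; apply: ((hA y (A y)).2 (conj Dy erefl)). Qed.

Lemma op_closed (T : Type) (F : set_system T) {FF : ProperFilter F}
    (u : T -> E) x y : (forall i, D (u i)) ->
  u i @[i --> F] --> x -> A (u i) @[i --> F] --> y -> D x /\ A x = y.
Proof.
move=> Du ux Auy; apply/hA => v Dv; rewrite !(ipC _ x) !(ipC v).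
have h1 : ip (u i) (A v) @[i --> F] --> ip x (A v) by exact: ip_cvgl.
have h2 : ip (u i) (A v) @[i --> F] --> ip y v.
  by under eq_fun do rewrite -op_sym //; exact: ip_cvgl.
exact: (cvg_unique (@Rhausdorff R) h1 h2).
Qed.

(** A - t, locked so that rewriting with linearity does not unfold it. *)
Definition opshift t x : E := locked (A x - t *: x).

Lemma opshiftE t x : opshift t x = A x - t *: x.
Proof. by rewrite /opshift -lock. Qed.

Lemma opshift_lin t a x y : D x -> D y ->
  opshift t (a *: x + y) = a *: opshift t x + opshift t y.
Proof.
move=> Dx Dy; rewrite !opshiftE op_linear // scalerDr opprD addrACA.
by rewrite scalerBr !scalerA mulrC.
Qed.

Lemma opshift_Z t a x : D x -> opshift t (a *: x) = a *: opshift t x.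
Proof. by move=> Dx; rewrite !opshiftE op_Z // scalerBr !scalerA mulrC. Qed.

Lemma opshift_D t x y : D x -> D y -> opshift t (x + y) = opshift t x + opshift t y.
Proof. by move=> Dx Dy; have := opshift_lin t 1 Dx Dy; rewrite !scale1r. Qed.

Lemma opshift_B t x y : D x -> D y -> opshift t (x - y) = opshift t x - opshift t y.
Proof.
move=> Dx Dy; rewrite addrC -scaleN1r opshift_lin // scaleN1r addrC //.
Qed.

Lemma opshift_sym t x y : D x -> D y -> ip (opshift t x) y = ip x (opshift t y).
Proof. by move=> Dx Dy; rewrite !opshiftE !ipE op_sym. Qed.

Lemma opshift_change t a x : opshift a x = opshift t x + (t - a) *: x.
Proof. by rewrite !opshiftE scalerBl addrA subrK. Qed.

Definition perp s x : Prop := forall e, e \in s -> ip x e = 0.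

(** The span of [s] lies in the domain and is invariant, so it reduces the
self-adjoint operator A: its orthogonal complement is invariant as well. *)
Definition reducing_frame s : Prop :=
  parseval_frame s /\ forall e, e \in s -> D e /\ lproj s (A e) = A e.

(** On the complement of the span of [s], t is a regular point of A: see
[opshift_surj]. *)
Definition bounded_below s t : Prop := exists2 c, 0 < c &
  forall x, D x -> perp s x -> c * `|x| <= `|opshift t x|.

Lemma reducing_frame_nil : reducing_frame [::].
Proof. by split. Qed.

Lemma perp_nil x : perp [::] x.
Proof. by []. Qed.

Lemma perp_lin s a x y : perp s x -> perp s y -> perp s (a *: x + y).
Proof. by move=> px py e es; rewrite !ipE px // py // mulr0 addr0. Qed.

Lemma perp_D s x y : perp s x -> perp s y -> perp s (x + y).
Proof. by move=> px py e es; rewrite !ipE px // py // addr0. Qed.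

Lemma perp_Z s a x : perp s x -> perp s (a *: x).
Proof. by move=> px e es; rewrite !ipE px // mulr0. Qed.

Lemma perp_B s x y : perp s x -> perp s y -> perp s (x - y).
Proof. by move=> px py e es; rewrite !ipE px // py // subr0. Qed.

Lemma perp_sub_lproj s x : parseval_frame s -> perp s (x - lproj s x).
Proof. by move=> hs e es; apply: lproj_perp. Qed.

Lemma ip_perp_lproj s x y : perp s x -> ip x (lproj s y) = 0.
Proof. by move=> px; rewrite -lproj_sym lproj_eq0 ?ip0l. Qed.

Lemma perp_cvg (T : Type) (F : set_system T) {FF : ProperFilter F}
    (u : T -> E) x s : (forall i, perp s (u i)) ->
  u i @[i --> F] --> x -> perp s x.
Proof. by move=> pu ux e es; apply: (ip_eq0_cvg ux) => i; apply: pu. Qed.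

Section Reduced.
Variables (s : seq E) (hs : reducing_frame s).

Lemma reduced_closed :
  (D 0 /\ lproj s (A 0) = A 0) /\
  forall a x y, D x /\ lproj s (A x) = A x -> D y /\ lproj s (A y) = A y ->
    D (a *: x + y) /\ lproj s (A (a *: x + y)) = A (a *: x + y).
Proof.
have A0 : A 0 = 0 by rewrite -(scale0r 0) op_Z ?scale0r //; apply: sub0.
split.
  rewrite A0 lproj_eq0 => [|e _]; last by rewrite ip0l.
  by split=> //; apply: sub0.
move=> a x y [Dx px] [Dy py]; split; first by apply: subD => //; apply: subZ.
by rewrite op_linear // lproj_linear px py.
Qed.

Lemma lproj_reduces x : D (lproj s x) /\ lproj s (A (lproj s x)) = A (lproj s x).
Proof. by apply: (@lproj_mem _ _ (Subspace reduced_closed)); case: hs. Qed.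

Lemma lproj_dom x : D (lproj s x). Proof. exact: (lproj_reduces x).1. Qed.

Lemma perp_op x : D x -> perp s x -> perp s (A x).
Proof.
case: hs => _ hs2 Dx px e es; have [De eA] := hs2 _ es.
by rewrite op_sym // -eA ip_perp_lproj.
Qed.

Lemma perp_opshift t x : D x -> perp s x -> perp s (opshift t x).
Proof.
move=> Dx px; rewrite opshiftE.
by apply: perp_B; [exact: perp_op|exact: perp_Z].
Qed.

(** A respects the decomposition into the span of [s] and its complement. *)
Lemma op_lproj_comm x : D x -> A (lproj s x) = lproj s (A x).
Proof.
move=> Dx; have hx := perp_sub_lproj x hs.1; have [Dp pA] := lproj_reduces x.
have := perp_op (subB Dx Dp) hx; rewrite op_B // => h.
by rewrite -{1}pA; apply/eqP; rewrite eq_sym -subr_eq0 -lprojB lproj_eq0.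
Qed.

Lemma opshift_range_closed t :
  let P m := exists x, [/\ D x, perp s x & m = opshift t x] in
  P 0 /\ forall a x y, P x -> P y -> P (a *: x + y).
Proof.
split=> [|a _ _ [x [Dx px ->]] [y [Dy py ->]]].
  exists 0; split; [exact: sub0|by move=> e _; rewrite ip0l|].
  have D0 := sub0 D.
  by have := opshift_lin t (-1) D0 D0; rewrite !scaler0 addr0 scaleN1r addNr.
exists (a *: x + y); split; last by rewrite opshift_lin.
  by apply: subD => //; apply: subZ.
exact: perp_lin.
Qed.

Definition opshift_range t : lin_subspace E := Subspace (opshift_range_closed t).

(** The image of the complement of [s] under A - t is dense in it: a vector [v] of
the complement orthogonal to the image is orthogonal to (A - t) x for every [x] in
the domain, so self-adjointness makes it an eigenvector for t, and boundedness
below makes it zero.  The image is closed because preimages of a Cauchy sequence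
are Cauchy and A is closed. *)
Lemma opshift_surj t z : bounded_below s t -> perp s z ->
  exists y, [/\ D y, perp s y & opshift t y = z].
Proof.
move=> [c c0 hc] pz.
have dense_z : forall eps : R, 0 < eps ->
    exists2 m, opshift_range t m & `|z - m| < eps.
  apply: dense_of_perp => w hw.
  pose v := w - lproj s w; have pv : perp s v by apply: perp_sub_lproj hs.1.
  have [Dv Av] : D v /\ A v = t *: v.
    apply/hA => x Dx; pose x1 := x - lproj s x.
    have Dp := lproj_dom x; have Dx1 : D x1 by apply: subB.
    have px1 : perp s x1 by apply: perp_sub_lproj hs.1.
    have h1 : ip (opshift t x1) v = 0.
      rewrite ipBr hw; last by exists x1.
      by rewrite ip_perp_lproj ?subrr //; apply: perp_opshift.
    have h2 : ip (opshift t (lproj s x)) v = 0.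
      rewrite opshiftE ipC ipBr op_lproj_comm // ipZr.
      by rewrite !ip_perp_lproj // mulr0 subr0.
    have : ip (opshift t x) v = 0.
      by rewrite -[x](subrK (lproj s x)) opshift_D // ipDl h1 h2 addr0.
    by rewrite opshiftE ipBl ipZl ipZr => /eqP; rewrite subr_eq0 => /eqP.
  have v0 : v = 0.
    apply/eqP; rewrite -normr_le0 -(ler_pM2l c0) mulr0.
    by apply: le_trans (hc _ Dv pv) _; rewrite !opshiftE Av subrr normr0.
  by rewrite -[w](subrK (lproj s w)) -/v v0 add0r ip_perp_lproj.
have /choice[x hx] : forall k : nat, exists x,
    [/\ D x, perp s x & `|z - opshift t x| < k.+1%:R^-1].
  move=> k; have ik : 0 < (k.+1%:R : R)^-1 by rewrite invr_gt0.
  by have [_ [x [Dx px ->]] lt] := dense_z _ ik; exists x.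
have Dx k : D (x k) by case: (hx k).
have px k : perp s (x k) by case: (hx k).
have sx k : `|z - opshift t (x k)| < k.+1%:R^-1 by case: (hx k).
have [y xy] : exists y : E, x k @[k --> \oo] --> y.
  apply: cauchy_limit => eps eps0.
  have e0 : 0 < c * eps / 2 by rewrite divr_gt0 // mulr_gt0.
  have [N hN] := inv_lt_eventually e0.
  exists [set k | (N <= k)%N]; first by exists N.
  move=> j k /= Nj Nk; rewrite -(ltr_pM2l c0).
  apply: le_lt_trans (hc _ (subB (Dx j) (Dx k)) (perp_B (px j) (px k))) _.
  rewrite opshift_B //.
  have -> (u v : E) : u - v = (z - v) - (z - u).
    by rewrite opprB [RHS]addrC subrKA.
  apply: le_lt_trans (ler_normB _ _) _.
  have := lt_trans (sx j) (hN _ Nj); have := lt_trans (sx k) (hN _ Nk); lra.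
have sxz : opshift t (x k) @[k --> \oo] --> z.
  apply/cvgrPdist_lt => eps eps0; have [N hN] := inv_lt_eventually eps0.
  by exists N => // k Nk; apply: lt_trans (sx k) (hN _ Nk).
have Ax : A (x k) @[k --> \oo] --> z + t *: y.
  have -> : (fun k => A (x k)) = (fun k => opshift t (x k) + t *: x k).
    by apply/funext => k; rewrite !opshiftE subrK.
  by apply: cvgD => //; apply: cvgZr.
have [Dy Ay] := op_closed Dx xy Ax.
exists y; split=> //; first exact: perp_cvg px xy.
by rewrite !opshiftE Ay addrK.
Qed.

(** Let Q(x, y) = <(A - a) x, (A - b) y>, a symmetric form, positive by hypothesis.
With z = (A - a) x choose y such that (A - b) y = z.  Then Q(x, y) = |z|^2, and
Q(y, y) is at most K |z|^2, so the Cauchy-Schwarz inequality for Q gives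
|z|^4 <= K |z|^2 Q(x, x); finally |z| bounds |x|. *)
Lemma gap_between_bounded_below a b : bounded_below s a -> bounded_below s b ->
  (forall x, D x -> perp s x -> 0 <= ip (opshift a x) (opshift b x)) ->
  exists2 d : R, 0 < d &
    forall x, D x -> perp s x -> d * `|x| ^+ 2 <= ip (opshift a x) (opshift b x).
Proof.
move=> [ca ca0 hca] hb Q0; have [cb cb0 hcb] := hb.
pose K := 1 + `|b - a| / cb.
have K0 : 0 < K by rewrite ltr_pwDl // divr_ge0 // ltW.
exists (ca ^+ 2 / K); first by rewrite divr_gt0 // exprn_gt0.
move=> x Dx px; set z := opshift a x.
have pz : perp s z by apply: perp_opshift.
have [y [Dy py ey]] := opshift_surj hb pz.
have Qsym u v : D u -> D v ->
    ip (opshift a u) (opshift b v) = ip (opshift a v) (opshift b u).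
  move=> Du Dv; rewrite !opshiftE !ipE (ipC (A v) (A u)) (ipC (A v) u).
  by rewrite (ipC v (A u)) (ipC v u) !(op_sym Du Dv); ring.
have CS : ip z z ^+ 2 <= ip z (opshift b x) * ip (opshift a y) z.
  rewrite -{2 4}ey; apply: discriminant_le; first exact: Q0.
  move=> t; have Dty := subZ t Dy.
  have := Q0 _ (subD Dx Dty) (perp_D px (perp_Z t py)).
  rewrite -[x + _]addrC !opshift_lin // -/z !ipE (Qsym y x) // -/z.
  by congr (0 <= _); rewrite ey; ring.
have yz : `|y| <= `|z| / cb by rewrite ler_pdivlMr // mulrC -ey; apply: hcb.
have Qy : ip (opshift a y) z <= K * `|z| ^+ 2.
  rewrite (opshift_change b) ey ipDl ipZl ip_norm /K (mulrDl 1) mul1r lerD2l.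
  apply: le_trans (ler_norm _) _; rewrite normrM.
  apply: le_trans (ler_wpM2l _ (cauchy_schwarz_ip _ _)) _ => //.
  have -> : `|b - a| / cb * `|z| ^+ 2 = `|b - a| * (`|z| / cb * `|z|) by ring.
  by rewrite ler_wpM2l // ler_wpM2r.
have Qx0 : 0 <= ip z (opshift b x) by apply: Q0.
have cz : ca * `|x| <= `|z| by apply: hca.
have zQ : `|z| ^+ 2 <= K * ip z (opshift b x).
  have [->|zn0] := eqVneq z 0; first by rewrite ip0l normr0 expr0n mulr0.
  have zp : 0 < `|z| ^+ 2 by rewrite exprn_gt0 // normr_gt0.
  rewrite -(ler_pM2r zp) -expr2 -{1}ip_norm (le_trans CS) //.
  by rewrite -mulrA [leRHS]mulrCA ler_wpM2l.
rewrite mulrAC ler_pdivrMr // mulrC (mulrC _ K) (le_trans _ zQ) // mulrC -exprMn.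
by rewrite ler_pXn2r // nnegrE ?mulr_ge0 ?(ltW ca0).
Qed.

(** Let q be the supremum of the constants in [0, r] for which the estimate holds.
It is attained.  If q < r, then
<(A - t - q) x, (A - t + q) x> = |(A - t) x|^2 - q^2 |x|^2 is nonnegative, and both
t + q and t - q are regular; [gap_between_bounded_below] then bounds it from
below by a positive multiple of |x|^2, so q can be increased. *)
Lemma gap_of_bounded_below t r : 0 <= r ->
  (forall u, `|u - t| < r -> bounded_below s u) ->
  forall x, D x -> perp s x -> r * `|x| <= `|opshift t x|.
Proof.
move=> r0 hr.
pose S := [set q : R | [/\ 0 <= q, q <= r &
  forall x, D x -> perp s x -> q * `|x| <= `|opshift t x|]].
have S0 : S 0 by split=> // x _ _; rewrite mul0r.
have Sub : ubound S r by move=> q [].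
have Ssup : has_sup S by split; [exists 0|exists r].
pose q := sup S.
have q0 : 0 <= q by apply: sup_upper_bound.
have qr : q <= r by apply: ge_sup => //; exists 0.
have hq x : D x -> perp s x -> q * `|x| <= `|opshift t x|.
  move=> Dx px; have [->|xn0] := eqVneq x 0; first by rewrite normr0 mulr0.
  have xp : 0 < `|x| by rewrite normr_gt0.
  rewrite -ler_pdivlMr //; apply: ge_sup; first by exists 0.
  by move=> p [_ _ hp]; rewrite ler_pdivlMr //; apply: hp.
have [rq|qr'] := leP r q.
  by have -> : r = q by apply/eqP; rewrite eq_le rq qr.
have b1 : bounded_below s (t + q) by apply: hr; rewrite addrAC subrr add0r ger0_norm.
have b2 : bounded_below s (t - q).
  by apply: hr; rewrite addrAC subrr add0r normrN ger0_norm.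
have Qe x : ip (opshift (t + q) x) (opshift (t - q) x)
    = `|opshift t x| ^+ 2 - (q * `|x|) ^+ 2.
  rewrite (opshift_change t (t + q)) (opshift_change t (t - q)).
  by rewrite -ip_norm exprMn -ip_norm !ipE (ipC x); ring.
have [|d d0 hd] := gap_between_bounded_below b1 b2.
  move=> x Dx px; rewrite Qe subr_ge0 ler_pXn2r ?nnegrE ?mulr_ge0 //.
  exact: hq.
have rp : 0 < r by apply: le_lt_trans q0 qr'.
pose h := Num.min (r - q) (d / (2 * r)).
have h0 : 0 < h.
  by rewrite lt_min subr_gt0 qr' divr_gt0 // mulr_gt0.
have hr1 : h <= r - q by rewrite ge_min lexx.
have hr2 : h * (2 * r) <= d.
  by rewrite -ler_pdivlMr ?mulr_gt0 // ge_min lexx orbT.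
(* (q + h)^2 <= q^2 + 2 r h <= q^2 + d, so q + h is admissible. *)
have : q + h <= q.
  apply: sup_upper_bound => //; split; [lra|lra|] => x Dx px.
  rewrite -(@ler_pXn2r _ 2) ?nnegrE ?mulr_ge0 //; last lra.
  have := hd x Dx px; rewrite Qe !exprMn.
  have : (q + h) ^+ 2 <= q ^+ 2 + d by nra.
  have := exprn_ge0 2 (normr_ge0 x); set n := `|x| ^+ 2; nra.
lra.
Qed.

End Reduced.
End SelfAdjoint.

(** * Isolated points of the spectrum and spectral subspaces *)

Section Discrete.
Context {R : realType} {E : hilbertType R} (A : operator E).
Hypothesis hA : self_adjoint A.
Local Notation D := (op_dom A).
Implicit Types (x y z e : E) (s : seq E) (t a b : R).

(** Write T = A - t.  The gaps on both sides of t give |T x|^2 >= d <T x, x> for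
d = eps and d = - eps.  Adding the two inequalities for the vectors eps x + T x
and eps x - T x yields |T T x| >= eps |T x|, that is, T is bounded below on its
image.  The image is dense in the complement of the kernel, but the bound has to
be carried over in the graph norm; this is done through the regular point
t0 = t + eps / 4, whose inverse is continuous from E to the graph space. *)
Lemma isolated_bounded_below t (eps : R) : 0 < eps ->
  (forall u, u != t -> `|u - t| < eps -> bounded_below A [::] u) ->
  exists2 c : R, 0 < c & forall y, D y ->
    (forall k, eigenspace_op A t k -> ip y k = 0) -> c * `|y| <= `|opshift A t y|.
Proof.
move=> eps0 hb; have hnil := reducing_frame_nil A; have pn := @perp_nil R E.
have H d x : d = eps \/ d = - eps -> D x ->
    d * ip (opshift A t x) x <= `|opshift A t x| ^+ 2.
  move=> hd Dx; have h : eps / 2 * `|x| <= `|opshift A (t + d / 2) x|.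
    apply: (gap_of_bounded_below hA hnil) => // [|u hu]; first lra.
    by apply: hb; [apply/eqP => ut|]; move: hu; rewrite ?ut; case: hd => ->;
      rewrite ltr_norml ?ltr_norml; lra.
  move: h; rewrite -(@ler_pXn2r _ 2) ?nnegrE ?mulr_ge0 //; last lra.
  rewrite exprMn (opshift_change A t) -!ip_norm; move: (opshift A t x) => q.
  by rewrite !ipE (ipC x q); case: hd => ->; lra.
(* T is bounded below on its image. *)
have H3 x : D x -> D (opshift A t x) ->
    eps * `|opshift A t x| <= `|opshift A t (opshift A t x)|.
  move=> Dx Dq; rewrite -(@ler_pXn2r _ 2) ?nnegrE ?mulr_ge0 ?(ltW eps0) //.
  have e : ip (opshift A t (opshift A t x)) x = ip (opshift A t x) (opshift A t x).
    by rewrite opshift_sym.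
  have sD : opshift A t (eps *: x + opshift A t x)
      = eps *: opshift A t x + opshift A t (opshift A t x).
    exact: opshift_lin.
  have sB : opshift A t (eps *: x - opshift A t x)
      = eps *: opshift A t x - opshift A t (opshift A t x).
    rewrite opshift_B //; last exact: subZ.
    by rewrite opshift_Z.
  have := H _ _ (or_introl erefl) (subD (subZ eps Dx) Dq); rewrite sD.
  have := H _ _ (or_intror erefl) (subB (subZ eps Dx) Dq); rewrite sB.
  move: e; move: (opshift A t (opshift A t x)) => r; move: (opshift A t x) => q e.
  rewrite exprMn -!ip_norm !ipE (ipC q r) e; lra.
pose t0 := t + eps / 4.
have [c0 c00 hc0] : bounded_below A [::] t0.
  apply: hb; first by apply/eqP; rewrite /t0; lra.
  by rewrite /t0 addrAC subrr add0r ger0_norm; lra.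
have b0 : bounded_below A [::] t0 by exists c0.
have e40 : `|t0 - t| = eps / 4 by rewrite /t0 addrAC subrr add0r ger0_norm //; lra.
(* The bound of the previous step, carried to A - t0 on vectors of the image. *)
have H4 u : D u -> exists y, [/\ D y, opshift A t0 y = opshift A t u &
    3 / 4 * eps * `|y| <= `|opshift A t u|].
  move=> Du; have [x [Dx _ xu]] := opshift_surj hA hnil b0 (@pn u).
  have ye : opshift A t x = u + (t0 - t) *: x by rewrite (opshift_change A t0) xu.
  have Dy : D (opshift A t x) by rewrite ye; apply: subD => //; apply: subZ.
  have sy : opshift A t0 (opshift A t x) = opshift A t u.
    rewrite {1}ye opshift_D //; last exact: subZ.
    by rewrite opshift_Z // xu [RHS](opshift_change A t0).
  exists (opshift A t x); split=> //.
  have := H3 _ Dx Dy; rewrite [opshift A t (opshift A t x)](opshift_change A t0) sy.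
  move=> h; have := le_trans h (ler_normD _ _); rewrite normrZ e40; lra.
exists (eps / 2); first lra.
move=> y Dy yk; pose z := opshift A t0 y.
have zk k : eigenspace_op A t k -> ip z k = 0.
  move=> ek; have [Dk Ak] := ek.
  rewrite /z (opshift_change A t) ipDl ipZl yk // mulr0 addr0 opshift_sym //.
  by rewrite opshiftE Ak subrr ip0r.
(* A vector orthogonal to the image of T lies in its kernel. *)
have zdense : forall d : R, 0 < d ->
    exists2 m, opshift_range A [::] t m & `|z - m| < d.
  apply: dense_of_perp => w hw; apply: zk; apply/hA => x Dx.
  have : ip (opshift A t x) w = 0 by apply: hw; exists x.
  by rewrite opshiftE ipBl ipZl ipZr => /eqP; rewrite subr_eq0 => /eqP.
have yz : 3 / 4 * eps * `|y| <= `|z|.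
  apply/ler_addgt0Pr => d d0.
  pose K := 1 + 3 / 4 * eps / c0.
  have K0 : 0 < K.
    by rewrite /K ltr_pwDl // divr_ge0 ?(ltW c00) // mulr_ge0 // ltW.
  have dK0 : 0 < d / K by rewrite divr_gt0.
  have [_ [u [Du _ ->]] zu] := zdense _ dK0.
  have [y' [Dy' sy' hy']] := H4 u Du.
  have := hc0 _ (subB Dy Dy') (@pn _).
  rewrite opshift_B // sy' -/z => h1.
  have h2 : c0 * `|y - y'| < d / K by apply: le_lt_trans h1 zu.
  have h3 : `|y| <= `|y'| + `|y - y'|.
    by rewrite -{1}(subrK y' y) addrC; apply: ler_normD.
  have h4 : `|opshift A t u| <= `|z| + `|z - opshift A t u|.
    by rewrite -{1}(subrK z (opshift A t u)) addrC distrC; apply: ler_normD.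
  have h5 : `|y - y'| <= d / K / c0.
    by rewrite ler_pdivlMr // mulrC ltW.
  have -> : d = d / K + 3 / 4 * eps * (d / K / c0).
    by rewrite /K; field; rewrite ?gt_eqF //=; lra.
  have : 3 / 4 * eps * `|y - y'| <= 3 / 4 * eps * (d / K / c0).
    by rewrite ler_wpM2l // mulr_ge0 // ltW.
  have : 3 / 4 * eps * `|y| <= 3 / 4 * eps * (`|y'| + `|y - y'|).
    by rewrite ler_wpM2l // mulr_ge0 // ltW.
  move: zu hy' h4; rewrite mulrDr; set p := 3 / 4 * eps * (d / K / c0).
  set q := d / K; lra.
have : `|z| <= `|opshift A t y| + eps / 4 * `|y|.
  rewrite /z (opshift_change A t) (le_trans (ler_normD _ _)) // lerD2l normrZ.
  by rewrite distrC e40.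
lra.
Qed.

Lemma resolvent_bounded_below t : resolvent_set A t -> bounded_below A [::] t.
Proof.
move=> [B [/linear_bounded_continuous/linear_boundedP/pinfty_ex_gt0[r r0 hr] _ BA]].
exists r^-1; first by rewrite invr_gt0.
move=> x Dx _; rewrite ler_pdivrMl // -{1}(BA _ Dx) -opshiftE; exact: hr.
Qed.

Lemma bounded_below_perp s t : bounded_below A [::] t -> bounded_below A s t.
Proof. by move=> [c c0 hc]; exists c => // x Dx _; apply: hc. Qed.

Hypothesis hspec : purely_discrete_spectrum A.

(** Every u with |u| < r is regular on the complement of [s]: this is clear for u in
the resolvent set, and otherwise u is isolated in the spectrum and its eigenvectors
lie in the span of [s]. *)
Lemma spectral_gap s r : reducing_frame A s -> 0 <= r ->
  (forall l x, spectrum A l -> `|l| < r -> eigenspace_op A l x -> lproj s x = x) ->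
  forall x, D x -> perp s x -> r * `|x| <= `|A x|.
Proof.
move=> hs r0 hl x Dx px; have := gap_of_bounded_below hA hs (t := 0) r0 _ Dx px.
rewrite opshiftE scale0r subr0; apply=> u; rewrite subr0 => ur.
have [/resolvent_bounded_below|su] := pselect (resolvent_set A u).
  exact: bounded_below_perp.
have [[eps eps0 iso] _ _] := hspec su.
have [|c c0 hc] := isolated_bounded_below eps0 (t := u).
  move=> v vu vlt; apply: resolvent_bounded_below; apply: contrapT => sv.
  by move/eqP: vu; apply; apply: iso.
exists c => // y Dy py; apply: hc => // k ek.
by rewrite -(hl u k su ur ek) ip_perp_lproj.
Qed.

(** A limit point of the spectrum would be a spectral value which is not isolated, or
a regular point; near the latter A - m is bounded below, so m is no eigenvalue. *)
Lemma finite_spectrum (r : R) : finite_set [set l | spectrum A l /\ `|l| <= r].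
Proof.
apply: contrapT => inf.
have [|l hl] := infinite_bounded_limit_point_nonempty inf.
  exists r; split; first exact: num_real.
  by move=> M rM l [_ lr]; apply: le_trans lr (ltW rM).
(* near l there is no spectral value other than l *)
have [eps eps0 iso] : exists2 eps : R, 0 < eps &
    forall m, spectrum A m -> `|m - l| < eps -> m = l.
  have [/resolvent_bounded_below[c c0 hc]|sl] := pselect (resolvent_set A l).
    exists c => // m sm ml; have [_ [x xn0 [Dx Ax]] _] := hspec sm.
    have := hc x Dx (@perp_nil _ _ x).
    by rewrite opshiftE Ax -scalerBl normrZ ler_pM2r ?normr_gt0 // leNgt ml.
  by have [] := hspec sl.
have [m [ml [sm _]]] : exists y : R,
    [/\ y != l, spectrum A y /\ `|y| <= r & ball l eps y].
  by apply: hl; apply: nbhsx_ballx.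
rewrite /ball /= distrC => /(iso _ sm) me.
by rewrite me eqxx in ml.
Qed.

Lemma eigen_Vle n l x : spectrum A l -> `|l| <= n%:R -> eigenspace_op A l x ->
  Vle A n x.
Proof.
move=> sl ln xl; exists [:: x]; last by rewrite big_seq1.
by move=> y; rewrite inE => /eqP ->; exists l.
Qed.

Lemma eigen_op l x : eigenspace_op A l x -> eigenspace_op A l (A x).
Proof.
move=> [Dx Ax]; rewrite /eigenspace_op /= Ax.
by split; [apply: subZ|rewrite op_Z // Ax].
Qed.

Lemma Vle_dom n x : Vle A n x -> D x.
Proof.
by move=> [s hs ->]; apply: sub_sum => y /hs[l _ []].
Qed.

Lemma Vle_op n x : Vle A n x -> Vle A n (A x).
Proof.
move=> [s hs ->]; elim: s hs => [|y s IH] hs.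
  by rewrite big_nil -(scale0r 0) op_Z ?scale0r; [apply: sub0|apply: sub0].
have [l [sl ln] yl] := hs y (mem_head _ _).
have hs' z : z \in s ->
    exists2 l, spectrum A l /\ `|l| <= n%:R & eigenspace_op A l z.
  by move=> zs; apply: hs; rewrite inE zs orbT.
rewrite big_cons op_D.
    by apply: subD (IH hs'); apply: eigen_Vle (eigen_op yl).
  by case: yl.
by apply: (@Vle_dom n); exists s.
Qed.

(** V_n is the sum of the finitely many eigenspaces with |l| <= n, each of which is
finite-dimensional. *)
Lemma Vle_span n : exists b : seq E, forall v, Vle A n v -> fspan b v.
Proof.
have /finite_seqP[L hL] := finite_spectrum n%:R.
have [b hb] : exists b : seq E, forall l x,
    l \in L -> eigenspace_op A l x -> fspan b x.
  have : forall l, l \in L -> spectrum A l.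
    by move=> l lL; have : [set` L] l by []; rewrite -hL => -[].
  elim: L {hL} => [|l L IH] hL; first by exists [::].
  have [|b hb] := IH; first by move=> m mL; apply: hL; rewrite inE mL orbT.
  have [_ _ /finite_dim_span[c hc]] := hspec (hL l (mem_head _ _)).
  exists (c ++ b) => m x; rewrite inE => /orP[/eqP ->|mL] xm.
    by apply: fspan_le (hc _ xm) => u uc; apply: fspan_mem; rewrite mem_cat uc.
  apply: fspan_le (hb _ _ mL xm) => u uc.
  by apply: fspan_mem; rewrite mem_cat uc orbT.
exists b => _ [s hs ->]; apply: (@sub_sum _ _ (span_of b)) => y /hs[l sl].
by apply: hb; have : [set` L] l by rewrite -hL.
Qed.

Lemma Vle_basis n : exists s, [/\ reducing_frame A s,
  (forall e, e \in s -> Vle A n e) & forall v, Vle A n v -> lproj s v = v].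
Proof.
have [b /finite_parseval_frame[s [s1 s2 s3]]] := Vle_span n.
exists s; split=> //; split=> // e /s2 es; split; first exact: Vle_dom es.
exact/s3/Vle_op.
Qed.

End Discrete.

(** * Quadratic functionals and the inner product of a subspace *)

Section Quadratic.
Context {R : realType} {V : innerType R} (T : {linear V -> V}) (C : R).
Hypothesis TC : forall x, `|T x| <= C * `|x|.
Hypothesis Tsym : forall x y, ip (T x) y = ip x (T y).

Lemma bounded_quadratic_diff x :
  let q := fun y : V => 2^-1 * ip (T y) y in
  differentiable q x /\ forall v, 'd q x v = ip (T x) v.
Proof.
move=> q.
pose d (v : V) : R^o := ip (T x) v.
have lind : linear d.
  by move=> a u v; rewrite /d ipDr ipZr.
pose dM := GRing.isLinear.Build _ _ _ _ _ lind.
pose dL : {linear V -> R^o} := HB.pack d dM.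
have dcont : continuous dL.
  apply: bounded_linear_continuous; apply/linear_boundedP.
  near=> r => y; apply: le_trans (cauchy_schwarz_ip _ _) _.
  by apply: ler_wpM2r => //; near: r; apply: nbhs_pinfty_ge; apply: num_real.
have dq : (q : V -> R^o) \o shift x = cst (q x : R^o) + dL +o_ (0 : V) id.
  apply/eqaddoP => eps eps0; near=> h.
  have -> : (((q : V -> R^o) \o shift x) - (cst (q x : R^o) + dL)) h
      = 2^-1 * ip (T h) h.
    by rewrite !fctE /= /q /d linearD !ipE (ipC (T x) h) -(Tsym h x); field.
  have hk : `|h| <= eps / (`|C| + 1).
    by near: h; apply: nbhs0_le; rewrite divr_gt0 // ltr_wpDl.
  have small : `|2^-1 * ip (T h) h : R| <= eps * `|h|.
    rewrite normrM ger0_norm ?invr_ge0 //.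
    apply: le_trans (ler_wpM2l _ (cauchy_schwarz_ip _ _)) _.
      by rewrite invr_ge0.
    rewrite mulrA ler_wpM2r //.
    have h1 : `|T h| <= `|C| * `|h|.
      by apply: le_trans (TC h) _; rewrite ler_wpM2r // ler_norm.
    have h2 : `|C| * `|h| <= eps.
      apply: le_trans (ler_wpM2l (normr_ge0 C) hk) _.
      rewrite mulrA ler_pdivrMr ?ltr_wpDl // mulrC.
      by rewrite ler_wpM2l ?(ltW eps0) // lerDl.
    have := normr_ge0 (T h); lra.
  exact: small.
have dqE := diff_unique dcont dq.
split; last by move=> v; rewrite dqE.
by apply/diff_locallyP; rewrite dqE.
Unshelve. all: by end_near. Qed.

End Quadratic.

Section SubSpace.
Context {R : realType} {E : innerType R} (W : lin_subspace E).
Implicit Types (x y z : sub_space W).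

Lemma sub_valP x : W (val x).
Proof. exact/asboolP/(valP x). Qed.

Lemma sub_ip x y : ip x y = ip (val x) (val y).
Proof. by []. Qed.

Lemma sub_norm x : `|x| = `|val x|.
Proof.
apply/eqP; rewrite -(@eqrXn2 _ 2) //.
by rewrite -!ip_norm sub_ip.
Qed.

Lemma sub_valB x y : val (x - y) = val x - val y.
Proof. exact: raddfB. Qed.

Lemma sub_valPM a x y : val (a *: x + y) = a *: val x + val y.
Proof. exact: linearP. Qed.

Lemma sub_valZ a x : val (a *: x) = a *: val x.
Proof. exact: linearZ_LR. Qed.

Lemma insubd_val (u : E) : W u -> val (insubd (0 : sub_space W) u) = u.
Proof. by move=> Wu; rewrite insubdK //; apply/asboolP. Qed.

Lemma restr_val (T : E -> E) x : W (T (val x)) -> val (restr T x) = T (val x).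
Proof. exact: insubd_val. Qed.

Lemma cvg_sub (T : Type) (F : set_system T) {FF : Filter F}
    (u : T -> sub_space W) x :
  val (u t) @[t --> F] --> val x -> u t @[t --> F] --> x.
Proof.
move=> h; apply/cvgrPdist_lt => eps eps0.
move/cvgrPdist_lt : h => /(_ _ eps0); apply: filterS => t.
by rewrite sub_norm sub_valB.
Qed.

Lemma sub_val_continuous : continuous (val : sub_space W -> E).
Proof.
move=> x; apply/(@cvgrPdist_lt _ _ _ (nbhs x)) => eps eps0.
near=> t; rewrite -sub_valB -sub_norm; near: t.
exact: cvgr_dist_lt.
Unshelve. all: by end_near. Qed.

Variables (s : seq E) (hs : parseval_frame s) (sW : forall e, e \in s -> W e).
Hypothesis sK : forall v, W v -> lproj s v = v.

Lemma sub_lproj_perp u v : W v -> ip (u - lproj s u) v = 0.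
Proof. by move=> /sK <-; rewrite -lproj_sym lprojB lproj_idem // subrr ip0l. Qed.

(** The orthogonal projection onto [W] exists, so the default value in its definition
is not taken, and it is given by the frame. *)
Lemma orth_proj_val u : val (orth_proj W u) = lproj s u.
Proof.
have Wp : W (lproj s u) by apply: lproj_mem.
have : [set w : sub_space W | forall v : sub_space W, ip (u - val w) (val v) = 0]
    (orth_proj W u).
  apply: xgetPex; exists (insubd 0 (lproj s u)) => v.
  by rewrite insubd_val // sub_lproj_perp //; apply: sub_valP.
set w := orth_proj W u; move=> /= hw; apply/eqP; rewrite -subr_eq0; apply/eqP.
apply: ip_eq0; set r := val w - lproj s u.
have Wr : W r by apply: subB => //; apply: sub_valP.
have e : r = (u - lproj s u) - (u - val w) by rewrite opprB [RHS]addrC subrKA.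
by rewrite {1}e ipBl sub_lproj_perp // sub0r -(insubd_val Wr) hw oppr0.
Qed.

Lemma sub_finite_dim : finite_dim [set: sub_space W].
Proof.
exists (size s), (fun i => insubd 0 (nth 0 s i)) => v _.
exists (fun i => ip (val v) (nth 0 s i)); apply: val_inj.
rewrite raddf_sum -{1}(sK (sub_valP v)) /lproj (big_nth 0) big_mkord.
apply: eq_bigr => i _; rewrite [RHS]sub_valZ insubd_val //.
by apply: sW; apply: mem_nth.
Qed.

End SubSpace.

(** * Equivariance *)

Section Rep.
Context {R : realType} {G : topGroupType} {E : innerType R}.
Context (rho : G -> E -> E) (hrho : orthogonal_rep rho).
Implicit Types (g : G) (x y u v : E) (W : lin_subspace E).

Lemma rep_lin g a x y : rho g (a *: x + y) = a *: rho g x + rho g y.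
Proof. by case: hrho. Qed.

Lemma rep_ip g x y : ip (rho g x) (rho g y) = ip x y.
Proof. by case: hrho. Qed.

Lemma rep_D g x y : rho g (x + y) = rho g x + rho g y.
Proof. by have := rep_lin g 1 x y; rewrite !scale1r. Qed.

Lemma rep_0 g : rho g 0 = 0.
Proof. by apply: (addrI (rho g 0)); rewrite -rep_D !addr0. Qed.

Lemma rep_Z g a x : rho g (a *: x) = a *: rho g x.
Proof. by have := rep_lin g a x 0; rewrite rep_0 !addr0. Qed.

Lemma rep_B g x y : rho g (x - y) = rho g x - rho g y.
Proof. by rewrite rep_D -scaleN1r rep_Z scaleN1r. Qed.

Lemma rep_norm g x : `|rho g x| = `|x|.
Proof. by apply/eqP; rewrite -(@eqrXn2 _ 2) // -!ip_norm rep_ip. Qed.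

Lemma rep_VK g x : rho g (rho g^-1%g x) = x.
Proof. by have [[h1 hM _] _ _] := hrho; rewrite -hM mulgV h1. Qed.

Lemma rep_adj g x y : ip (rho g x) y = ip x (rho g^-1%g y).
Proof. by rewrite -{1}(rep_VK g y) rep_ip. Qed.

(** Differentiate phi (rho g x) = phi x, using that rho g is a linear isometry. *)
Lemma rep_gradient (phi : E -> R) (grad : E -> E) :
  (forall x, differentiable phi x) -> is_gradient phi grad ->
  (forall g x, phi (rho g x) = phi x) ->
  forall g x, grad (rho g x) = rho g (grad x).
Proof.
move=> dphi hgrad inv g x.
pose M := GRing.isLinear.Build _ _ _ _ (rho g) (rep_lin g).
pose L : {linear E -> E} := HB.pack (rho g) M.
have Lc : continuous L.
  apply: bounded_linear_continuous; apply/linear_boundedP.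
  exists 1; split=> [//|r r1 y]; rewrite [`|L y|]rep_norm ler_peMl //; exact: ltW.
have dL : differentiable L x by apply: linear_differentiable.
have e : phi \o L = phi by apply/funext => y; apply: inv.
apply: ip_ext => z; rewrite -[z](rep_VK g) rep_ip -!hgrad.
have := diff_comp dL (dphi (L x)); rewrite e (diff_lin _ Lc) => dE.
exact: esym (congr1 (fun h : E -> R => h (rho g^-1%g z)) dE).
Qed.

(** Both sides are the projection of [rho g u] to [W], as [W] and its complement are
invariant. *)
Lemma lproj_rep s W : parseval_frame s -> (forall e, e \in s -> W e) ->
  (forall v, W v -> lproj s v = v) -> act_invariant rho W ->
  forall g u, lproj s (rho g u) = rho g (lproj s u).
Proof.
move=> hs sW sK Winv g u; apply/eqP; rewrite -subr_eq0; apply/eqP/ip_eq0.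
set d := (X in ip X _).
have Wd : W d by apply: subB; [|apply: Winv]; apply: lproj_mem.
rewrite {1}/d ipBl lproj_sym (sK _ Wd) !rep_adj lproj_sym sK ?subrr //.
exact: Winv.
Qed.

Lemma rho_on_val W g (x : sub_space W) : act_invariant rho W ->
  val (@rho_on _ _ _ rho W g x) = rho g (val x).
Proof. by move=> Winv; rewrite restr_val //; apply/Winv/sub_valP. Qed.

Lemma rho_on_rep W : act_invariant rho W -> orthogonal_rep (@rho_on _ _ _ rho W).
Proof.
move=> Winv; have [[h1 hM hc] _ _] := hrho; split; first split.
- by move=> x; apply: val_inj; rewrite rho_on_val // h1.
- by move=> g h x; apply: val_inj; rewrite !rho_on_val // hM.
- move=> p; apply: cvg_sub; rewrite rho_on_val //.
  under eq_fun do rewrite rho_on_val //.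
  apply: (@continuous_comp _ _ _ (fun q : G * sub_space W => (q.1, val q.2))
    (fun q : G * E => rho q.1 q.2)); last exact: hc.
  apply: cvg_pair; first exact: cvg_fst.
  apply: (@cvg_comp _ _ _ snd (val : sub_space W -> E) _ (nbhs p.2)).
    exact: cvg_snd.
  exact: sub_val_continuous.
- move=> g a x y; apply: val_inj.
  by rewrite sub_valPM !rho_on_val // sub_valPM rep_lin.
- by move=> g x y; rewrite !sub_ip !rho_on_val // rep_ip.
Qed.

End Rep.

(** * The approximations are gradient maps *)

Section Graph.
Context {R : realType} {E : innerType R} (A : operator E).
Implicit Types x y : graph_space A.

Lemma graph_dom x : op_dom A (val x).
Proof. exact/asboolP/(valP x). Qed.

Lemma graph_valB x y : val (x - y) = val x - val y.
Proof. exact: raddfB. Qed.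

Lemma graph_insub (u : E) : op_dom A u -> val (insubd (0 : graph_space A) u) = u.
Proof. by move=> Du; rewrite insubdK //; apply/asboolP. Qed.

Lemma graph_normE x : `|x| ^+ 2 = `|val x| ^+ 2 + `|A (val x)| ^+ 2.
Proof. by rewrite -!ip_norm. Qed.

Lemma graph_norm_ge x : `|A (val x)| <= `|x|.
Proof.
by rewrite -(@ler_pXn2r _ 2) ?nnegrE // graph_normE lerDr exprn_ge0.
Qed.

Lemma graph_norm_val x : `|val x| <= `|x|.
Proof.
by rewrite -(@ler_pXn2r _ 2) ?nnegrE // graph_normE lerDl exprn_ge0.
Qed.

Lemma graph_norm_le x : `|x| <= `|val x| + `|A (val x)|.
Proof.
rewrite -(@ler_pXn2r _ 2) ?nnegrE ?addr_ge0 // graph_normE sqrrD.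
by rewrite addrAC lerDl mulrn_wge0 // mulr_ge0.
Qed.

End Graph.

Section Gradient.
Context {R : realType} {E : innerType R}.

(** Test the estimate for the differentials on the difference of the gradients. *)
Lemma gradient_continuous (phi : E -> R) (grad : E -> E) :
  C1_functional phi -> is_gradient phi grad -> continuous grad.
Proof.
move=> [_ C1] hgrad x; apply/(@cvgrPdist_le _ _ _ (nbhs x)) => eps eps0.
have := C1 x eps eps0; apply: filterS => y /(_ (grad y - grad x)).
rewrite !hgrad -ipBl ip_norm ger0_norm ?exprn_ge0 // expr2 !(distrC (grad y)).
have [->|n0] := eqVneq (grad x - grad y) 0; first by rewrite normr0 (ltW eps0).
by rewrite ler_pM2r // normr_gt0.
Qed.

End Gradient.

Section Approx.
Context {R : realType} {G : topGroupType} {E : hilbertType R}.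
Context (rho : G -> E -> E) (hrho : orthogonal_rep rho) (A : operator E).
Hypothesis (hA : self_adjoint A) (hAeq : equivariant_op rho A).

Lemma op_lproj_sum s x : (forall e, e \in s -> op_dom A e) ->
  A (lproj s x) = \sum_(e <- s) ip x e *: A e.
Proof.
rewrite /lproj; elim: s => [|e s IH] hs.
  by rewrite !big_nil -(scale0r 0) op_Z ?scale0r //; apply: sub0.
have hs' z : z \in s -> op_dom A z by move=> zs; apply: hs; rewrite inE zs orbT.
have De : op_dom A e by apply: hs; rewrite mem_head.
rewrite !big_cons op_D ?op_Z ?IH //; first exact: subZ.
by apply: sub_sum => i /hs' Di; apply: subZ.
Qed.

Variable n : nat.
Variables (s : seq E) (hs : reducing_frame A s).
Hypothesis sW : forall e, e \in s -> Vle A n e.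
Hypothesis sK : forall v, Vle A n v -> lproj s v = v.

Lemma Vle_rep : act_invariant rho (Vle A n).
Proof.
move=> g _ [t ht ->]; elim: t ht => [|y t IH] ht.
  by rewrite big_nil (rep_0 hrho); apply: sub0.
rewrite big_cons (rep_D hrho); apply: subD.
  have [l [sl ln] [Dy Ay]] := ht y (mem_head _ _).
  apply: (eigen_Vle sl ln); split; first exact: hAeq.1.
  by rewrite hAeq.2 // Ay (rep_Z hrho).
by apply: IH => z zs; apply: ht; rewrite inE zs orbT.
Qed.

Lemma op_bounded_Vle : exists C : R, forall x, Vle A n x -> `|A x| <= C * `|x|.
Proof.
exists (\sum_(e <- s) `|e| * `|A e|) => x Vx.
rewrite -{1}(sK Vx) op_lproj_sum; last by move=> e /hs.2[].
apply: le_trans (ler_norm_sum _ _ _) _; rewrite mulr_suml; apply: ler_sum => e _.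
rewrite normrZ mulrAC ler_wpM2r // mulrC; exact: cauchy_schwarz_ip.
Qed.

Variable f : local_map rho A.

Lemma approx_val x :
  val (@approx_fun _ _ _ _ _ f n x) = A (val x) - lproj s (lm_grad f (val x)).
Proof.
rewrite /approx_fun sub_valB (orth_proj_val hs.1 sW sK) restr_val //.
exact/Vle_op/sub_valP.
Qed.

(** On V_n the graph norm and the norm of E are equivalent. *)
Lemma approx_dom_open (U : set (graph_space A)) :
  open U -> open (@approx_dom _ _ A U n).
Proof.
move=> oU; rewrite openE => x [y Uy yx].
have [C hC] := op_bounded_Vle.
have /nbhs_ballP[eps /= eps0 hU] : nbhs y U by apply: open_nbhs_nbhs.
pose d := eps / (1 + `|C|).
have C0 : 0 < 1 + `|C| by rewrite ltr_pwDl.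
have d0 : 0 < d by rewrite divr_gt0.
apply/nbhs_ballP; exists d => // x'; rewrite -ball_normE /= => xx'.
have Dx' : op_dom A (val x') by apply/Vle_dom/sub_valP.
exists (insubd 0 (val x')); last exact: graph_insub.
apply: hU; rewrite -ball_normE /=; apply: le_lt_trans (graph_norm_le _) _.
rewrite graph_valB graph_insub // yx -sub_valB.
apply: le_lt_trans (_ : (1 + `|C|) * `|x - x'| < eps); last first.
  by rewrite mulrC -ltr_pdivlMr.
rewrite mulrDl mul1r -sub_norm lerD2l (le_trans (hC _ (sub_valP _))) //.
by rewrite -sub_norm ler_wpM2r // ler_norm.
Qed.

Lemma approx_dom_inv (U : set (graph_space A)) : invariant1 rho U ->
  act_invariant (@rho_on _ _ _ rho (Vle A n)) (@approx_dom _ _ A U n).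
Proof.
move=> invU g x [y Uy yx].
have e : val (insubd (0 : graph_space A) (rho g (val y))) = rho g (val y).
  by apply: graph_insub; apply: hAeq.1; apply: graph_dom.
exists (insubd 0 (rho g (val y))); first exact: invU Uy e.
by rewrite e yx rho_on_val //; apply: Vle_rep.
Qed.

Lemma restr_linear : linear (restr A : sub_space (Vle A n) -> sub_space (Vle A n)).
Proof.
move=> a x y; apply: val_inj.
have V (z : sub_space (Vle A n)) : Vle A n (A (val z)) by apply/Vle_op/sub_valP.
rewrite sub_valPM !restr_val // sub_valPM.
exact: op_linear (Vle_dom (sub_valP x)) (Vle_dom (sub_valP y)).
Qed.

Lemma lproj_cvg (T : Type) (F : set_system T) {FF : Filter F} (u : T -> E) x :
  u t @[t --> F] --> x -> lproj s (u t) @[t --> F] --> lproj s x.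
Proof.
move=> /cvgrPdist_lt ux; apply/cvgrPdist_lt => eps eps0.
apply: filterS (ux _ eps0) => t; apply: le_lt_trans.
by rewrite -lprojB; apply: lproj_norm hs.1.
Qed.

(** The potential is <A x, x> / 2 - phi x on V_n.  The zero set is
empty, hence compact. *)
Lemma approx_gradient_map (U : set (graph_space A)) :
  open U -> invariant1 rho U ->
  (forall x, @approx_dom _ _ A U n x -> @approx_fun _ _ _ _ _ f n x <> 0) ->
  gradient_map (@rho_on _ _ _ rho (Vle A n)) (@approx_dom _ _ A U n)
    (@approx_fun _ _ _ _ _ f n).
Proof.
move=> oU invU noz; pose W := Vle A n.
have Vop (x : sub_space W) : W (A (val x)) by apply/Vle_op/sub_valP.
have gradc := gradient_continuous (lm_pot_C1 f) (@lm_gradP _ _ _ _ _ f).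
pose M := GRing.isLinear.Build _ _ _ _ _ restr_linear.
pose L : {linear sub_space W -> sub_space W} := HB.pack (restr A) M.
have Lval x : val (L x) = A (val x) by apply: restr_val.
have [C hC] := op_bounded_Vle.
have LC x : `|L x| <= C * `|x| by rewrite !sub_norm Lval; apply/hC/sub_valP.
have Lc : continuous L.
  apply: bounded_linear_continuous; apply/linear_boundedP.
  exists C; split=> [|r Cr x]; first exact: num_real.
  by apply: le_trans (LC x) _; rewrite ler_wpM2r // ltW.
have Lsym x y : ip (L x) y = ip x (L y).
  by rewrite !sub_ip !Lval op_sym //; apply/Vle_dom/sub_valP.
split.
- by split; [exact: approx_dom_open|exact: approx_dom_inv].
- apply: continuous_subspaceT => x; apply: (@cvg_sub _ _ _ _ _ (nbhs_filter x)).
  rewrite approx_val; under eq_fun do rewrite approx_val.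
  apply: cvgB.
    rewrite -Lval; under eq_fun do rewrite -Lval.
    apply: (@cvg_comp _ _ _ L (val : sub_space W -> E) _ (nbhs (L x))).
      exact: Lc.
    exact: sub_val_continuous.
  apply: lproj_cvg.
  apply: (@cvg_comp _ _ _ (val : sub_space W -> E) (lm_grad f) _ (nbhs (val x))).
    exact: sub_val_continuous.
  exact: gradc.
- move=> g x _; apply: val_inj.
  have Dx : op_dom A (val x) by apply/Vle_dom/sub_valP.
  rewrite rho_on_val ?approx_val //; last exact: Vle_rep.
  rewrite rho_on_val; last exact: Vle_rep.
  rewrite hAeq.2 // (rep_B hrho); congr (_ - _).
  rewrite (rep_gradient hrho (lm_pot_C1 f).1 (@lm_gradP _ _ _ _ _ f)); last first.
    exact: lm_pot_inv.
  exact: (lproj_rep hrho hs.1 sW sK Vle_rep).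
- pose vl : {linear sub_space W -> E} := val.
  pose q := fun y : sub_space W => 2^-1 * ip (L y) y.
  exists (q - (lm_pot f \o val)) => x Ox.
  have [dq dqE] := bounded_quadratic_diff LC Lsym x.
  have dv : differentiable vl x.
    by apply: linear_differentiable; exact: sub_val_continuous.
  have dvE : 'd vl x = vl :> (sub_space W -> E).
    by apply: diff_lin; exact: sub_val_continuous.
  have dp : differentiable (lm_pot f) (vl x) by exact: (lm_pot_C1 f).1.
  have dc : differentiable (lm_pot f \o vl) x by apply: differentiable_comp.
  split; first exact: differentiableB.
  move=> v; have -> : 'd (q - (lm_pot f \o vl)) x v
      = 'd q x v - 'd (lm_pot f \o vl) x v by rewrite diffB.
  rewrite dqE (diff_comp dv dp) /= dvE (@lm_gradP _ _ _ _ _ f).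
  rewrite !sub_ip approx_val Lval ipBl; congr (_ - _).
  by rewrite lproj_sym sK //; apply: sub_valP.
- suff -> : [set x | @approx_dom _ _ A U n x /\
    @approx_fun _ _ _ _ _ f n x = 0] = set0.
    exact: compact0.
  by apply/seteqP; split=> // x [/noz].
Qed.

End Approx.

(** * Compactness *)

Section Ultra.
Context {R : realType} (T : Type) (F : set_system T) (FU : UltraFilter F).

Lemma ultra_fmap (S : Type) (u : T -> S) : UltraFilter (u @ F).
Proof.
split; first exact: fmap_proper_filter.
move=> H HP FH; apply/seteqP; split=> // B HB.
have [//|nB] := in_ultra_setVsetC (u @^-1` B) FU.
have HnB : H (~` B) by apply: FH.
have [x [Bx nBx]] := filter_ex (filterI HB HnB).
by case: nBx.
Qed.

Lemma ultra_real (u : T -> R) (C : R) : (forall t, `|u t| <= C) ->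
  exists l : R, u t @[t --> F] --> l.
Proof.
move=> uC; have := @segment_compact R (- C) C.
rewrite compact_ultra => /(_ _ (ultra_fmap u)) [|l [_ ul]]; last by exists l.
suff : F (u @^-1` `[- C, C]) by [].
by apply: filterS filterT => t _; rewrite /= in_itv /= -ler_norml.
Qed.

(** An ultrafilter spares the diagonal extraction of subsequences: all the coordinates
converge along it at once. *)
Lemma ultra_lproj (E : innerType R) (s : seq E) (u : T -> E) (C : R) :
  (forall t, `|u t| <= C) -> exists p : E, lproj s (u t) @[t --> F] --> p.
Proof.
move=> uC; rewrite /lproj; elim: s => [|e s [p sp]].
  by exists 0; under eq_fun do rewrite big_nil; apply: cvg_cst.
have [|l ul] := @ultra_real (fun t => ip (u t) e) (C * `|e|).
  by move=> t; apply: le_trans (cauchy_schwarz_ip _ _) _; rewrite ler_wpM2r.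
exists (l *: e + p); under eq_fun do rewrite big_cons.
by apply: cvgD => //; apply: cvgZl.
Qed.

End Ultra.

Section Compactness.
Context {R : realType} {G : topGroupType} {E : hilbertType R}.
Context (rho : G -> E -> E) (A : operator E).
Hypothesis (hA : self_adjoint A) (hD : densely_defined A).
Variables (s : nat -> seq E).
Hypothesis hs : forall n, reducing_frame A (s n).
Hypothesis sK : forall n v, Vle A n v -> lproj (s n) v = v.
Hypothesis hspec : purely_discrete_spectrum A.

(** [spectral_gap] for x - P_n x, whose image A x - P_n A x has norm at most
2 |A x|. *)
Lemma spectral_tail_bound n x : op_dom A x ->
  n%:R * `|x - lproj (s n) x| <= 2 * `|A x|.
Proof.
move=> Dx; have Dp := lproj_dom (hs n) x.
have := spectral_gap hA hspec (hs n) (ler0n R n) _ (subB Dx Dp)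
  (perp_sub_lproj (s := s n) x (hs n).1).
rewrite op_B // (op_lproj_comm hA (hs n)) // => h.
apply: le_trans (h _) _.
  by move=> l y sl ln yl; apply: sK; apply: eigen_Vle sl (ltW ln) yl.
apply: le_trans (ler_normB _ _) _; rewrite mulrDl mul1r lerD2l.
exact: lproj_norm (hs n).1.
Qed.

(** On the domain of A this is [spectral_tail_bound]; the domain is dense and the
projections are contractions. *)
Lemma lproj_cvg_id y : lproj (s n) y @[n --> \oo] --> y.
Proof.
apply/cvgrPdist_lt => eps eps0.
have e4 : 0 < eps / 4 by rewrite divr_gt0.
have [d [Dd yd]] : exists d, op_dom A d /\ `|y - d| < eps / 4.
  have [|d [yd Dd]] := hD (O := ball y (eps / 4)) _ (ball_open y (eps / 4)).
    by exists y; apply: ballxx.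
  by exists d; split=> //; move: yd; rewrite -ball_normE.
pose N := Num.truncn (2 * `|A d| / (eps / 4)).
exists N.+1 => // n /= Nn.
have h1 : `|d - lproj (s n) d| < eps / 4.
  have n0 : 0 < n%:R :> R by rewrite ltr0n (leq_trans _ Nn).
  rewrite -(ltr_pM2l n0); apply: le_lt_trans (spectral_tail_bound n Dd) _.
  rewrite -ltr_pdivrMr //.
  have q0 : 0 <= 2 * `|A d| / (eps / 4) by rewrite divr_ge0 ?mulr_ge0 // ltW.
  have := truncn_itv q0 => /andP[_] /lt_le_trans; apply.
  by rewrite ler_nat.
have h2 : `|lproj (s n) (y - d)| < eps / 4.
  by apply: le_lt_trans (lproj_norm _ (hs n).1) yd.
have -> : y - lproj (s n) y
    = (y - d) + ((d - lproj (s n) d) - lproj (s n) (y - d)).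
  by rewrite lprojB opprB !subrKA.
apply: le_lt_trans (ler_normD _ _) _.
have := ler_normB (d - lproj (s n) d) (lproj (s n) (y - d)); lra.
Qed.

Variable f : local_map rho A.

(** The x_k are bounded in the graph norm.  Along an ultrafilter they are Cauchy in E,
since their projections to a fixed V_N converge and the remainders are uniformly
small; then A x_k converges to the gradient at the limit. *)
Lemma zero_of_approx_zeros (U : set (graph_space A)) (x : nat -> graph_space A)
    (m : nat -> nat) :
  admissible f U -> (forall k, U (x k)) -> (forall k, (k <= m k)%N) ->
  (forall k, A (val (x k)) = lproj (s (m k)) (lm_grad f (val (x k)))) ->
  exists z, lm_dom f z /\ lm_fun f z = 0.
Proof.
move=> [oU [C0 [_ bU]] _ _ clU] Ux km Ax.
have [C [C1 xC]] : exists C : R, 0 < C /\ forall k, `|x k| <= C.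
  exists (`|C0| + 1); split; first by rewrite ltr_wpDl.
  move=> k; apply: bU (Ux k); apply: le_lt_trans (ler_norm _) _.
  by rewrite ltrDl.
have [F [FU oF]] := @ultraFilterLemma _ (\oo : set_system nat) _.
have FP : ProperFilter F by exact: ultra_proper.
have vC k : `|val (x k)| <= C := le_trans (graph_norm_val _) (xC k).
have AC k : `|A (val (x k))| <= C := le_trans (graph_norm_ge _) (xC k).
have Dx k : op_dom A (val (x k)) := graph_dom _.
have [y xy] : exists y : E, val (x k) @[k --> F] --> y.
  apply: cauchy_limit => eps eps0.
  pose N := (Num.truncn (2 * C / (eps / 4))).+1.
  have N0 : 0 < N%:R :> R by rewrite ltr0n.
  have tl k : `|val (x k) - lproj (s N) (val (x k))| < eps / 4.
    rewrite -(ltr_pM2l N0); apply: le_lt_trans (spectral_tail_bound N (Dx k)) _.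
    have q0 : 0 <= 2 * C / (eps / 4).
      by rewrite divr_ge0 ?mulr_ge0 ?divr_ge0 // ltW.
    have /andP[_] := truncn_itv q0; rewrite -/N ltr_pdivrMr ?divr_gt0 //.
    by apply: le_lt_trans; rewrite ler_pM2l.
  have [p pp] := ultra_lproj FU (s N) vC.
  have e4 : 0 < eps / 4 by rewrite divr_gt0.
  exists [set k | `|p - lproj (s N) (val (x k))| < eps / 4].
    by move/cvgrPdist_lt : pp => /(_ _ e4).
  move=> j k /= pj pk; have := tl j; have := tl k; move: pj pk.
  move: (lproj (s N) (val (x k))) => a; move: (lproj (s N) (val (x j))) => b.
  move=> pj pk tk tj.
  have -> : val (x j) - val (x k)
      = ((val (x j) - b) - (p - b)) - ((val (x k) - a) - (p - a)).
    by rewrite !(opprB p) !subrKA (opprB _ p) subrKA.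
  apply: le_lt_trans (ler_normB _ _) _.
  have := ler_normB (val (x j) - b) (p - b).
  have := ler_normB (val (x k) - a) (p - a); lra.
pose w := lm_grad f y.
have gw : lm_grad f (val (x k)) @[k --> F] --> w.
  apply: (@cvg_comp _ _ _ (fun k => val (x k)) (lm_grad f) _ (nbhs y)) => //.
  exact: (gradient_continuous (lm_pot_C1 f) (@lm_gradP _ _ _ _ _ f)).
have Aw : A (val (x k)) @[k --> F] --> w.
  apply/cvgrPdist_lt => eps eps0; have e2 : 0 < eps / 2 by rewrite divr_gt0.
  have [N _ hN] : \forall n \near \oo, `|w - lproj (s n) w| < eps / 2.
    by have /cvgrPdist_lt/(_ _ e2) := @lproj_cvg_id w.
  have FN : F [set k | (N <= k)%N] by apply: oF; exists N.
  have Fg : F [set k | `|w - lm_grad f (val (x k))| < eps / 2].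
    by move/cvgrPdist_lt : gw => /(_ _ e2).
  apply: filterS (filterI FN Fg) => k [/= Nk gk]; rewrite Ax.
  have h1 := hN (m k) (leq_trans Nk (km k)).
  have h2 := lproj_norm (w - lm_grad f (val (x k))) (hs (m k)).1.
  rewrite lprojB in h2.
  rewrite -(subrK (lproj (s (m k)) w) w) -addrA.
  apply: le_lt_trans (ler_normD _ _) _; lra.
have [Dy Ay] := op_closed hA Dx xy Aw.
have yv : val (insubd (0 : graph_space A) y) = y by apply: graph_insub.
exists (insubd 0 y); split; last by rewrite /lm_fun yv Ay subrr.
apply: clU => B /nbhs_ballP[eps /= eps0 hB].
have e2 : 0 < eps / 2 by rewrite divr_gt0.
have F1 : F [set k | `|y - val (x k)| < eps / 2].
  by move/cvgrPdist_lt : xy => /(_ _ e2).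
have F2 : F [set k | `|w - A (val (x k))| < eps / 2].
  by move/cvgrPdist_lt : Aw => /(_ _ e2).
have [k [/= k1 k2]] := filter_ex (filterI F1 F2).
exists (x k); split=> //; apply: hB; rewrite -ball_normE /=.
apply: le_lt_trans (graph_norm_le _) _.
rewrite graph_valB yv op_B // Ay -/w; lra.
Qed.

End Compactness.

(** * The existence theorem *)

(** The normalization formula of the degree with no zero orbits. *)
Lemma degree_no_zero (R : realType) (G : topGroupType) (UG : comUnitRingType)
    (cls : forall X : topologicalType, (G -> X -> X) -> UG)
    (deg : forall V : innerType R, (G -> V -> V) -> set V -> (V -> V) -> UG)
    (hdeg : gradient_degree cls deg)
    (V : innerType R) (rho : G -> V -> V) (Om : set V) (f : V -> V) :
  finite_dim [set: V] -> orthogonal_rep rho -> gradient_map rho Om f ->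
  (forall x, Om x -> f x <> 0) -> @deg V rho Om f = 0.
Proof.
move=> fd hr hg noz.
have := @deg_normal _ _ _ _ _ hdeg V rho fd hr Om f hg 0 (fun=> 0) (fun=> 0%N)
  (fun _ _ => 0) (fun=> 0).
rewrite big_ord0; apply.
- by move=> y; split=> [[/noz]|[[]]].
- by case.
- by case.
Qed.

Theorem mainTheorem3 (R : realType)
  (G : topGroupType) (hG : compact_lie_group R G)
  (UG : comUnitRingType)
  (cls : forall X : topologicalType, (G -> X -> X) -> UG)
  (hUG : euler_tom_dieck_ring R cls)
  (deg : forall V : innerType R, (G -> V -> V) -> set V -> (V -> V) -> UG)
  (hdeg : gradient_degree cls deg)
  (E : hilbertType R) (hE : separable E)
  (rho : G -> E -> E) (hrho : orthogonal_rep rho)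
  (A : operator E) (hAdense : densely_defined A) (hAsa : self_adjoint A)
  (hAspec : purely_discrete_spectrum A) (hAeq : equivariant_op rho A)
  (f : local_map rho A) :
  Deg deg f <> 0 ->
  exists x : graph_space A, lm_dom f x /\ lm_fun f x = 0.
Proof.
have /choice[s hs] := Vle_basis hAspec.
have sI n : reducing_frame A (s n) by case: (hs n).
have sW n e : e \in s n -> Vle A n e by case: (hs n) => _ h _; apply: h.
have sK n v : Vle A n v -> lproj (s n) v = v by case: (hs n) => _ _; apply.
rewrite /Deg; case: xgetP => [u _ [U adm [N _ hN]] u0|_ //].
have [oU _ invU _ _] := adm.
have zeros n : exists x : graph_space A, exists m : nat,
    [/\ U x, (n <= m)%N & A (val x) = lproj (s m) (lm_grad f (val x))].
  pose m := maxn n N.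
  have [[x [[y Uy yx] fx]]|noz] :=
    pselect (exists x, @approx_dom _ _ A U m x /\
      @approx_fun _ _ _ _ _ f m x = 0).
    exists y, m; split=> //; first exact: leq_maxl.
    have := congr1 val fx; rewrite (approx_val (sI m) (@sW m) (@sK m)).
    by move=> /eqP; rewrite subr_eq0 yx => /eqP.
  case: u0; rewrite (hN m); last exact: leq_maxr.
  have gm := approx_gradient_map hrho hAsa hAeq (sI m) (@sW m) (@sK m)
    (f := f) oU invU (fun x Ox fx => noz (ex_intro _ x (conj Ox fx))).
  rewrite (degree_no_zero hdeg (sub_finite_dim (@sW m) (@sK m)) _ gm) ?mulr0 //.
    exact: (rho_on_rep hrho (Vle_rep hrho hAeq (n := m))).
  by move=> x Ox fx; apply: noz; exists x.
have /choice[x /choice[m xm]] := zeros.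
apply: (zero_of_approx_zeros hAsa hAdense sI sK hAspec adm (x := x) (m := m));
  by move=> k; case: (xm k).
Qed.
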